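(* Let $\mu$ be a compactly supported probability measure on $\mathbb{C}$ with a continuous, radial density function (radial around the origin, with respect to Lebesgue measure). Let $z_1, z_2, \dots$ be independent random variables with distribution $\mu$, and let $p_n(z) = \prod_{k=1}^{n}(z-z_k)$. Let $w_1,\dots,w_n$ be the $n$ complex solutions (counted with multiplicity) of $p_n(w) = p_n(0)$. Then $$\frac{1}{n}\sum_{k=1}^{n}\delta_{w_k} \to \mu \qquad \text{in the sense of distributions, in probability, as } n\to\infty.$$
   Context: $\delta_w$ denotes the Dirac measure at $w\in\mathbb{C}$. Convergence of random measures $\nu_n \to \mu$ in the sense of distributions, in probability, means that for every test function $f\in C_c^\infty(\mathbb{C})$ the random variables $\int f\,d\nu_n$ converge in probability to $\int f\,d\mu$. *)

(* Defs.v *)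
From HB Require Import structures.
From mathcomp Require Import all_boot all_order all_algebra.
From mathcomp Require Import complex.
From mathcomp Require Import all_classical all_reals all_analysis.

Set Implicit Arguments.
Unset Strict Implicit.
Unset Printing Implicit Defensive.

Import Order.TTheory GRing.Theory Num.Theory.
Import numFieldNormedType.Exports.

Local Open Scope classical_set_scope.
Local Open Scope complex_scope.
Local Open Scope ring_scope.

(* The complex plane is R * R wherever topology, measure or differentiation is
   involved (product topology, product sigma-algebra), and R[i] wherever
   polynomials are involved. *)
Definition to_C (R : realType) (u : R * R) : R[i] := u.1 +i* u.2.

(* [lebesgue_measure] lives on [measurableTypeR R], an alias of R with another
   measure display but the same (Borel) measurable sets. *)
Definition lebesgue2 (R : realType) :
    {measure set (measurableTypeR R * measurableTypeR R) -> \bar R} :=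
  (@lebesgue_measure R \x @lebesgue_measure R)%E.

Definition msupport (R : realType) (mu : probability (R * R)%type R) :
    set (R * R) :=
  [set u | forall U : set (R * R), open_nbhs u U -> (0 < mu U)%E].

Definition has_density (R : realType) (mu : probability (R * R)%type R)
    (g : R * R -> R) : Prop :=
  (forall u, 0 <= g u) /\
  (forall A : set (R * R), measurable A ->
    mu A = (\int[lebesgue2 R]_(u in A) (g u)%:E)%E).

(* The modulus is taken in R[i]: the norm of R * R is the sup norm. *)
Definition radial (R : realType) (g : R * R -> R) : Prop :=
  forall u v : R * R, `|to_C u| = `|to_C v| -> g u = g v.

Definition mutually_independent d d' (T : measurableType d)
    (T' : measurableType d') (R : realType) (P : probability T R)
    (X : nat -> {RV P >-> T'}) : Prop :=
  forall (s : seq nat) (A : nat -> set T'), uniq s ->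
    (forall k, measurable (A k)) ->
    P (\bigcap_(k in [set` s]) (X k @^-1` A k)) =
      (\prod_(k <- s) P (X k @^-1` A k))%E.

Arguments mutually_independent {d d' T T' R} P X.

Fixpoint Ck (R : realType) (m : nat) (f : R * R -> R) : Prop :=
  if m is m'.+1 then
    [/\ continuous f,
        (forall u : R * R, derivable f u (1, 0) /\ derivable f u (0, 1)),
        Ck m' ('D_(1, 0) f) & Ck m' ('D_(0, 1) f)]
  else continuous f.

Definition test_function (R : realType) (f : R * R -> R) : Prop :=
  (forall m, Ck m f) /\ compact (closure [set u : R * R | f u != 0]).

Definition cvg_in_probability d (T : measurableType d) (R : realType)
    (P : probability T R) (X : nat -> T -> R) (c : R) : Prop :=
  (forall n, measurable_fun setT (X n)) /\
  (forall eps : R, 0 < eps ->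
    P [set omega | eps <= `|X n omega - c|] @[n --> \oo] --> 0%E).

Definition cvg_distributions_in_probability d (T : measurableType d)
    (R : realType) (P : probability T R)
    (nu : nat -> T -> {measure set (R * R) -> \bar R})
    (mu : {measure set (R * R) -> \bar R}) : Prop :=
  forall f : R * R -> R, test_function f ->
    cvg_in_probability P (fun n omega => \int[nu n omega]_u f u)
      (\int[mu]_u f u).

Definition empirical_measure (R : realType) (n : nat) (w : nat -> R * R) :
    {measure set (R * R) -> \bar R} :=
  mscale (n%:R^-1)%:nng (msum (fun k => \d_(w k)) n).

Definition root_poly (R : realType) (n : nat) (z : nat -> R * R) :
    {poly R[i]} :=
  \prod_(k < n) ('X - (to_C (z k))%:P).

(* w 0, ..., w (n-1) lists the solutions x of p(x) = p(0), each one as many times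
   as its multiplicity as a root of p - p(0). *)
Definition solutions_of_level (R : realType) (n : nat) (p : {poly R[i]})
    (w : nat -> R * R) : Prop :=
  forall x : R[i],
    #|[set k : 'I_n | to_C (w k) == x]%SET| = mup x (p - (p.[0])%:P).

(* Main.v *)
(* Fix a fine grid of horizontal and vertical lines. With high probability
   |p_n(u)| > |p_n(0)| at every point u of the grid outside a disc D around 0 that
   carries little, but some, mass of mu. Hence no root of p_n - t p_n(0), 0 <= t <= 1,
   crosses the grid outside D as t goes from 0 to 1, so that each cell of the grid away
   from D contains as many solutions w_k as points z_k, and the cells meeting D contain
   together few of either. As the z_k obey the law of large numbers, so do the w_k.

   The inequality |p_n(u)| > |p_n(0)| holds since n^-1 log|p_n(u)/p_n(0)| is close to the
   integral of log|u - w| - log|w|, which is that of log max(|u|, |w|) - log|w| because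
   mu is radial, and is therefore positive. *)
Require Import Defs.
From HB Require Import structures.
From mathcomp Require Import all_boot all_order all_algebra.
From mathcomp Require Import complex.
From mathcomp Require Import all_classical all_reals all_analysis.
From mathcomp Require Import measurable_realfun zify ring lra.
Set Implicit Arguments.
Unset Strict Implicit.
Unset Printing Implicit Defensive.
Import Order.TTheory GRing.Theory Num.Theory.
Import numFieldNormedType.Exports.
Local Open Scope classical_set_scope.
Local Open Scope ring_scope.

(** * Continuity of roots *)

(** The obstacle is that [log|u - w|] is unbounded and that the grid contains uncountably many [u].
    The logarithm is therefore cut off at a small radius around its pole: the cut-off integrand is
    bounded and Lipschitz in [u], so that Chebyshev's inequality on a finite net is enough. The
    error of the cut-off is controlled by the distance from [z_k] to the grid line, which bounds
    [|u - z_k|] below and does not involve [u]; as the density is bounded, thin strips carry little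
    mass and this error has small mean. Of [|p_n(0)|] only an upper bound is needed, so [|w|] may be
    replaced by [max(|w|, s)]. The disc of radius [s] has positive mass, and for [|u| >= r1 > s]
    this keeps the integral above a constant [D > 0]; hence the two radii. The potential is needed
    only from below, and roots of unity replace the integral over circles. The [w_k] come in an
    arbitrary enumeration, without measurability; sums of [f] over them are continuous in the [z_k],
    hence measurable. *)

Lemma near_factor (C : numFieldType) (x : C) (s : seq C) : s != [::] ->
  exists2 a, a \in s & `|x - a| ^+ size s <= `|(\prod_(y <- s) ('X - y%:P)).[x]|.
Proof.
elim: s => // b s IH _; have [->|/IH [a sa le]] := eqVneq s [::].
  by exists b; rewrite ?mem_head// big_seq1 hornerXsubC expr1.
rewrite big_cons hornerM hornerXsubC normrM.
(* Of the old candidate [a] and the new root [b], the one nearer to [x] is kept: the least factor,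
   raised to the number of factors, is at most the product. *)
have [ab|ba] := real_leP (normr_real (x - a)) (normr_real (x - b)).
  exists a; first by rewrite inE sa orbT.
  by rewrite exprS ler_pM// exprn_ge0.
exists b; first exact: mem_head.
rewrite exprS ler_wpM2l// (le_trans _ le)// lerXn2r ?nnegrE// ltW//.
Qed.

(** Synthetic division, run downwards from the common degree bound [n]: each coefficient of the
    quotient is obtained from the next higher one, so convergence is passed on by descending
    induction on [j]. *)
Lemma cvg_coef_root_quotient (C : numFieldType) (S : Type) (F : set_system S)
    (FF : Filter F) (a : S -> C) (a0 : C) (q : S -> {poly C}) (q0 : {poly C})
    (n : nat) :
  a @ F --> a0 ->
  (forall s, (size (q s) <= n)%N) -> (size q0 <= n)%N ->
  (forall j, (fun s => (('X - (a s)%:P) * q s)`_j) @ F --> (('X - a0%:P) * q0)`_j) ->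
  forall j, (fun s => (q s)`_j) @ F --> q0`_j.
Proof.
move=> aa0 sq sq0 qq0 j.
have [i ] := ubnP (n - j)%N; elim: i j => // i IH j nji.
have [nj|jn] := leqP n j.
  have -> : (fun s => (q s)`_j) = fun=> 0.
    by apply/funext => s; rewrite nth_default// (leq_trans (sq s)).
  by rewrite nth_default ?(leq_trans sq0)//; exact: cvg_cst.
have recE (b : C) (r : {poly C}) : r`_j = (('X - b%:P) * r)`_j.+1 + b * r`_j.+1.
  by rewrite mulrBl coefB coefXM coefCM /= subrK.
rewrite (recE a0 q0); under eq_fun => s do rewrite (recE (a s) (q s)).
apply: cvgD; first exact: qq0.
by apply: cvgM => //; apply: IH; rewrite subnS -ltnS prednK// subn_gt0.
Qed.

Lemma cvg_bigsum (K : numFieldType) (S I : Type) (F : set_system S)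
    (FF : Filter F) (r : seq I) (f : I -> S -> K) (a : I -> K) :
  (forall i, f i @ F --> a i) ->
  (fun s => \sum_(i <- r) f i s) @ F --> \sum_(i <- r) a i.
Proof.
move=> fa; elim: r => [|i r IH].
  by rewrite big_nil; under eq_fun do rewrite big_nil; exact: cvg_cst.
rewrite big_cons; under eq_fun do rewrite big_cons.
exact: (cvgD (fa i) IH).
Qed.

Lemma cvg_horner_coef (C : numFieldType) (S : Type) (F : set_system S)
    (FF : Filter F) (q : S -> {poly C}) (q0 : {poly C}) (n : nat) (x : C) :
  (forall s, (size (q s) <= n)%N) -> (size q0 <= n)%N ->
  (forall j, (fun s => (q s)`_j) @ F --> q0`_j) ->
  (fun s => (q s).[x]) @ F --> q0.[x].
Proof.
move=> sq sq0 qq0.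
rewrite (horner_coef_wide _ sq0); under eq_fun => s do rewrite (horner_coef_wide _ (sq s)).
by apply: cvg_bigsum => i; apply: cvgM => //; exact: cvg_cst.
Qed.

(* As the coefficients converge, the root of the moving polynomial nearest to a root u0
   of the limit tends to u0, and both can be divided out. *)
Lemma cvg_sum_roots (C : numFieldType) (R : realType) (S : Type) (F : set_system S)
    (FF : Filter F) (f : C -> R) (u : seq C) (v : S -> seq C) :
  (forall x, x \in u -> {for x, continuous f}) ->
  (forall s, size (v s) = size u) ->
  (forall j, (fun s => (\prod_(y <- v s) ('X - y%:P))`_j) @ F -->
             (\prod_(y <- u) ('X - y%:P))`_j) ->
  (fun s => \sum_(y <- v s) f y) @ F --> \sum_(y <- u) f y.
Proof.
elim: u v => [|u0 u IH] v fu sv vu.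
  rewrite big_nil; under eq_fun => s do rewrite (size0nil (sv s)) big_nil.
  exact: cvg_cst.
have /choice[a aP] : forall s, exists a, a \in v s /\
    `|u0 - a| ^+ size (v s) <= `|(\prod_(y <- v s) ('X - y%:P)).[u0]|.
  move=> s; have [|a ? ?] := @near_factor C u0 (v s); last by exists a.
  by rewrite -size_eq0 sv.
have sQ (s : seq C) : size s = (size u).+1 ->
    (size (\prod_(y <- s) ('X - y%:P))%R <= (size u).+2)%N.
  by move=> su; rewrite size_prod_XsubC su.
(* [u0] is a root of the limit, so the values of the moving polynomials at [u0] tend to 0; they
   dominate a fixed power of [|u0 - a s|]. *)
have a_cvg : a @ F --> u0.
  have := cvg_horner_coef FF (fun s => sQ _ (sv s)) (sQ (u0 :: u) erefl) vu (x := u0).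
  rewrite big_cons hornerM hornerXsubC subrr mul0r => /cvgr0Pnorm_lt q0.
  apply/cvgrPdist_lt => e e0; near=> s.
  have [_] := aP s; rewrite sv => le.
  rewrite -(@ltr_pXn2r _ (size u).+1) ?nnegrE ?(ltW e0)//.
  apply: le_lt_trans le _; near: s; apply: q0; exact: exprn_gt0.
have pv s : perm_eq (v s) (a s :: rem (a s) (v s)) by apply: perm_to_rem; case: (aP s).
have szr s : size (rem (a s) (v s)) = size u.
  by rewrite size_rem ?sv//; case: (aP s).
rewrite big_cons; under eq_fun => s do rewrite (perm_big _ (pv s)) big_cons.
apply: cvgD.
  by apply: cvg_comp a_cvg _; apply: fu; exact: mem_head.
apply: IH => // [x xu|]; first by apply: fu; rewrite inE xu orbT.
apply: (@cvg_coef_root_quotient _ _ _ _ a u0 _ _ (size u).+1) => // [s||j].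
- by rewrite size_prod_XsubC szr.
- by rewrite size_prod_XsubC.
have := vu j; rewrite big_cons.
by under eq_fun => s do rewrite (perm_big _ (pv s)) big_cons.
Unshelve. all: by end_near.
Qed.

(** Different values at 0 and 1 would force, by the intermediate value theorem, a value [m + 1/2] in
    between, which no natural number takes. *)
Lemma integer_valued_constant (R : realType) (N : R -> nat) :
  (forall t : R, 0 <= t <= 1 -> ((N s)%:R : R) @[s --> t] --> ((N t)%:R : R)) ->
  N 0 = N 1.
Proof.
move=> cN; set f := fun s => (N s)%:R : R.
have cf : {within `[0, 1], continuous f}.
  apply: continuous_in_subspaceT => t; rewrite inE/= in_itv/= => t01.
  exact: cN.
have val v : Num.min (f 0) (f 1) <= v <= Num.max (f 0) (f 1) -> exists m : nat, v = m%:R.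
  by move=> /(IVT ler01 cf)[t _ <-]; exists (N t).
have half (m n : nat) : (m%:R + 1 / 2 : R) <> n%:R.
  move=> mn; have /eqP : (m.*2.+1%:R : R) = n.*2%:R.
    by rewrite -natr1 -!muln2 !natrM -mn; field.
  by rewrite eqr_nat => /eqP /(congr1 odd); rewrite oddS !odd_double.
have sep (m n : nat) : (m < n)%N ->
    ((m%:R : R) <= m%:R + 1 / 2 :> R) && ((m%:R + 1 / 2 : R) <= n%:R :> R).
  by rewrite -(ler_nat R) -natr1 => mn; apply/andP; split; lra.
have [lt|gt|//] := ltngtP (N 0) (N 1).
  have [k /half//] := val _ ltac:(rewrite min_l ?max_r ?ler_nat ?(ltnW lt)//; exact: sep lt).
have [k /half//] := val _ ltac:(rewrite min_r ?max_l ?ler_nat ?(ltnW gt)//; exact: sep gt).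
Qed.

Lemma locally_constant_continuous (C : numFieldType) (R : realType) (f : C -> R)
    (x e : C) :
  0 < e -> (forall y, `|x - y| < e -> f y = f x) -> {for x, continuous f}.
Proof.
move=> e0 fx; apply: cvg_near_cst; first exact: (nbhs_filter x).
by exists e => //= y; exact: fx.
Qed.

(** A homotopy argument: for [0 <= t <= 1] the roots of [p - i t * c] lie in the region
    [|p| <= |c|], where the labelling [psi] is locally constant. The number of roots with a given
    label is thus a sum over the roots of a function continuous at each of them, so it is continuous
    in [t], and being an integer it is constant. The path [i] stands for the embedding of the reals
    into [C]. *)
Lemma perm_map_roots_level (R : realType) (C : numClosedFieldType) (i : R -> C)
    (K : eqType) (psi : C -> K) (z w : seq C) (c : C) :
  (forall (t : R) (e : C), 0 < e -> \forall s \near t, `|i t - i s| < e) ->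
  i 0 = 0 -> i 1 = 1 ->
  (forall t, 0 <= t <= 1 -> `|i t| <= 1) ->
  (forall x, `|(\prod_(y <- z) ('X - y%:P)).[x]| <= `|c| ->
     exists2 e, 0 < e & forall y, `|x - y| < e -> psi y = psi x) ->
  size w = size z ->
  \prod_(y <- w) ('X - y%:P) = \prod_(y <- z) ('X - y%:P) - c%:P ->
  perm_eq (map psi w) (map psi z).
Proof.
move=> ci i0 i1 ile psi_loc sw wz; set p := \prod_(y <- z) _ in psi_loc wz.
have [z0|z_neq0] := eqVneq z [::].
  by move: sw; rewrite z0 => /size0nil ->.
have sz_gt1 : (1 < size p)%N.
  by rewrite size_prod_XsubC ltnS lt0n size_eq0.
have /choice[v vE] : forall t, exists r : seq C, p - (i t * c)%:P = \prod_(y <- r) ('X - y%:P).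
  move=> t; have [r rE] := closed_field_poly_normal (p - (i t * c)%:P).
  exists r; rewrite {1}rE lead_coefDl ?size_polyN ?(leq_ltn_trans (size_polyC_leq1 _))//.
  by rewrite /p lead_coef_prod_XsubC scale1r.
have szv t : size (v t) = size z.
  have := congr1 (fun q : {poly C} => size q) (vE t).
  rewrite /= size_polyDl ?size_polyN ?(leq_ltn_trans (size_polyC_leq1 _))//.
  by rewrite !size_prod_XsubC => -[].
have v0 : perm_eq (v 0) z.
  by apply: prod_XsubC_eq; rewrite -vE i0 mul0r subr0.
have v1 : perm_eq (v 1) w.
  by apply: prod_XsubC_eq; rewrite -vE i1 mul1r wz.
suff cnt k : count_mem k (map psi w) = count_mem k (map psi z).
  by apply/allP => k _ /=; rewrite cnt.
rewrite !count_map -(permP v0) -(permP v1).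
apply/esym/(@integer_valued_constant R (fun t => count (preim psi (pred1 k)) (v t))) => t t01.
have cntE s : (count (preim psi (pred1 k)) (v s))%:R =
   \sum_(y <- v s) (psi y == k)%:R :> R.
  by rewrite -sum1_count natr_sum big_mkcond; apply: eq_bigr => y _ /=; case: eqP.
under eq_fun do rewrite cntE; rewrite cntE.
apply: (@cvg_sum_roots _ _ _ _ _ (fun y => (psi y == k)%:R)) => [x xv|s|j].
- have : `|p.[x]| <= `|c|.
    have /eqP : root (p - (i t * c)%:P) x by rewrite vE root_prod_XsubC.
    rewrite hornerD hornerN hornerC => /eqP; rewrite subr_eq0 => /eqP ->.
    by rewrite normrM ler_piMl ?ile.
  move=> /psi_loc[e e0 px]; apply: (locally_constant_continuous e0) => y xy.
  by rewrite px.
- by rewrite !szv.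
- rewrite -vE; under eq_fun => s do rewrite -vE coefB.
  rewrite coefB; apply: cvgB; first exact: cvg_cst.
  rewrite coefC; under eq_fun do rewrite coefC; case: eqP => _; last exact: cvg_cst.
  by apply: cvgM; [apply/cvgrPdist_lt => e; exact: (ci t)|exact: cvg_cst].
Qed.

(** * Solutions of p(w) = p(0) in the plane *)

Lemma gt0_realE (R : realType) (e : R[i]) : 0 < e ->
  e = (complex.Re e)%:C%C /\ 0 < complex.Re e.
Proof.
move=> e0; have eE : e = (complex.Re e)%:C%C.
  by apply/eqP; rewrite eq_complex eqxx/= eq_sym; move: e0; rewrite ltcE => /andP[/eqP->].
by split; [|rewrite -ltcR -eE].
Qed.

(** The Euclidean length; the norm of [R * R] is the sup norm. The two are equivalent, so either one
    describes the topology. *)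
Definition modulus (R : realType) (u : R * R) : R :=
  Num.sqrt (u.1 ^+ 2 + u.2 ^+ 2).

Section modulus.
Variable R : realType.
Implicit Types u v : R * R.
Local Open Scope complex_scope.

Lemma normC_to_C u : `|to_C u| = (modulus u)%:C.
Proof. by rewrite normc_def. Qed.

Lemma to_CB u v : to_C (u - v) = to_C u - to_C v.
Proof. by []. Qed.

Lemma modulus_ge0 u : 0 <= modulus u.
Proof. exact: sqrtr_ge0. Qed.

Lemma modulus0 : modulus (0 : R * R) = 0.
Proof. by rewrite /modulus /= expr0n /= addr0 sqrtr0. Qed.

Lemma modulusN u : modulus (- u) = modulus u.
Proof. by rewrite /modulus /= !sqrrN. Qed.

Lemma modulusBC u v : modulus (u - v) = modulus (v - u).
Proof. by rewrite -modulusN opprB. Qed.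

Lemma ler_modulusD u v : modulus (u + v) <= modulus u + modulus v.
Proof.
rewrite -lecR -normC_to_C rmorphD/= -!normC_to_C.
by rewrite (_ : to_C (u + v) = to_C u + to_C v)// ler_normD.
Qed.

Lemma ler_modulusB u v : modulus u <= modulus v + modulus (u - v).
Proof. by rewrite -{1}(subrKC v u) ler_modulusD. Qed.

Lemma ler_fst_modulus u : `|u.1| <= modulus u.
Proof. by rewrite -sqrtr_sqr ler_wsqrtr// lerDl sqr_ge0. Qed.

Lemma ler_snd_modulus u : `|u.2| <= modulus u.
Proof. by rewrite -sqrtr_sqr ler_wsqrtr// lerDr sqr_ge0. Qed.

Lemma ler_modulus_norms u : modulus u <= `|u.1| + `|u.2|.
Proof.
rewrite -[leRHS]ger0_norm ?addr_ge0// -sqrtr_sqr ler_wsqrtr//.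
by rewrite sqrrD !real_normK ?num_real// addrAC lerDl mulrn_wge0// mulr_ge0.
Qed.

Lemma ler_norm_modulus u : `|u| <= modulus u.
Proof. by rewrite prod_normE ge_max ler_fst_modulus ler_snd_modulus. Qed.

Lemma ler_modulus_norm u : modulus u <= 2 * `|u|.
Proof.
rewrite (le_trans (ler_modulus_norms u))// mulr_natl mulr2n prod_normE.
by rewrite lerD// le_max lexx ?orbT.
Qed.

Lemma near_modulus u (e : R) : 0 < e -> \forall v \near u, modulus (u - v) < e.
Proof.
move=> e0; have e20 : 0 < e / 2 by rewrite divr_gt0.
near=> v; apply: le_lt_trans (ler_modulus_norm _) _.
by rewrite mulrC -ltr_pdivlMr//.
Unshelve. all: by end_near.
Qed.

Lemma modulus_lipschitz u v : `|modulus u - modulus v| <= modulus (u - v).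
Proof.
have := ler_modulusB v u; rewrite (modulusBC v) ler_norml => vu.
have uv := ler_modulusB u v; apply/andP; split; lra.
Qed.

Lemma modulus_continuous : continuous (@modulus R).
Proof.
move=> u; apply/cvgrPdist_lt => e e0; near=> v.
by apply: le_lt_trans (modulus_lipschitz u v) _; near: v; exact: near_modulus.
Unshelve. all: by end_near.
Qed.

Definition of_C (x : R[i]) : R * R := (complex.Re x, complex.Im x).

Lemma to_CK : cancel (@to_C R) of_C. Proof. by case. Qed.
Lemma of_CK : cancel of_C (@to_C R). Proof. by case. Qed.

Definition root_seq (n : nat) (z : nat -> R * R) : seq R[i] :=
  [seq to_C (z k) | k <- iota 0 n].

Lemma size_root_seq n z : size (root_seq n z) = n.
Proof. by rewrite size_map size_iota. Qed.

Lemma iotaE n : iota 0 n = index_iota 0 n.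
Proof. by rewrite /index_iota subn0. Qed.

Lemma root_polyE n z :
  root_poly n z = \prod_(y <- root_seq n z) ('X - y%:P).
Proof. by rewrite big_map iotaE big_mkord. Qed.

Lemma norm_root_poly n z u :
  `|(root_poly n z).[to_C u]| = (\prod_(k < n) modulus (u - z k))%:C.
Proof.
rewrite horner_prod normr_prod rmorph_prod/=; apply: eq_bigr => k _.
by rewrite hornerXsubC -to_CB normC_to_C.
Qed.

(** For [n > 0] subtracting a constant leaves the polynomial monic, so it is the product over its
    roots, and equal multiplicities make [w] a permutation of them. For [n = 0] the difference would
    be the zero polynomial. *)
Lemma solutions_root_poly n z w : (0 < n)%N ->
  solutions_of_level n (root_poly n z) w ->
  \prod_(y <- root_seq n w) ('X - y%:P) =
  root_poly n z - ((root_poly n z).[0])%:P.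
Proof.
move=> n0 sol; set p := _ - _.
have sz : (1 < size (root_poly n z))%N.
  by rewrite root_polyE size_prod_XsubC size_root_seq ltnS.
have [r rE] := closed_field_poly_normal p.
have pm : lead_coef p = 1.
  rewrite lead_coefDl ?size_polyN ?(leq_ltn_trans (size_polyC_leq1 _))//.
  by rewrite root_polyE lead_coef_prod_XsubC.
have pE : p = \prod_(y <- r) ('X - y%:P) by rewrite {1}rE pm scale1r.
rewrite pE; apply: perm_big.
apply/allP => x _ /=; apply/eqP.
rewrite -[RHS]mu_prod_XsubC -pE -sol.
rewrite -sum1_card -sum1_count big_map iotaE big_mkord.
by apply: eq_bigl => k; rewrite inE.
Qed.

(* Each of the polynomials p - t p(0), 0 <= t <= 1, has its roots in {|p| <= |p(0)|},
   so no root can jump between two components of this set as t grows. *)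
Lemma perm_map_solutions n z w (K : eqType) (psi : R * R -> K) : (0 < n)%N ->
  solutions_of_level n (root_poly n z) w ->
  (forall u, \prod_(k < n) modulus (u - z k) <= \prod_(k < n) modulus (z k) ->
    exists2 e, 0 < e & forall v, modulus (u - v) < e -> psi v = psi u) ->
  perm_eq [seq psi (w k) | k <- iota 0 n] [seq psi (z k) | k <- iota 0 n].
Proof.
move=> n0 sol psi_loc.
have mapE (v : nat -> R * R) : [seq psi (v k) | k <- iota 0 n] = map (psi \o of_C) (root_seq n v).
  by rewrite -map_comp; apply: eq_map => k /=; rewrite to_CK.
rewrite !mapE.
apply: (@perm_map_roots_level R R[i] (fun t => t%:C) _ _ _ _ (root_poly n z).[0]) => //.
- move=> t e /gt0_realE[-> e0].
  by near=> s; rewrite -rmorphB/= normc_def/= expr0n/= addr0 sqrtr_sqr ltcR.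
- move=> t /andP[t0 t1]; rewrite normc_def/= expr0n/= addr0 sqrtr_sqr.
  by rewrite ger0_norm// (lecR t 1).
- move=> x; rewrite -root_polyE -(of_CK x) norm_root_poly.
  have -> : (0 : R[i]) = to_C (0 : R * R) by [].
  rewrite norm_root_poly lecR => pu.
  have [|e e0 he] := psi_loc (of_C x).
    by apply: le_trans pu _; under eq_bigr do rewrite sub0r modulusN.
  exists e%:C => [|y]; first by rewrite ltcR.
  rewrite -{1}(of_CK y) -to_CB normC_to_C ltcR => /he.
  by rewrite /= to_CK.
- by rewrite !size_root_seq.
- by rewrite (solutions_root_poly n0 sol) {1}root_polyE.
Unshelve. all: by end_near.
Qed.

End modulus.

Lemma cvg_coef_prod_XsubC (C : numFieldType) (S : Type) (F : set_system S)
    (FF : Filter F) (n : nat) (z : S -> nat -> C) (z0 : nat -> C) (j : nat) :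
  (forall k, (fun s => z s k) @ F --> z0 k) ->
  (fun s => (\prod_(k < n) ('X - (z s k)%:P))`_j) @ F -->
    (\prod_(k < n) ('X - (z0 k)%:P))`_j.
Proof.
move=> zz0; elim: n j => [|n IH] j.
  by rewrite big_ord0; under eq_fun do rewrite big_ord0; exact: cvg_cst.
have recE (p : {poly C}) a : (p * ('X - a%:P))`_j =
    (if j == 0%N then 0 else p`_j.-1) - p`_j * a.
  by rewrite mulrBr coefB coefMX coefMC.
rewrite big_ord_recr recE; under eq_fun do rewrite big_ord_recr recE.
apply: cvgB; last by apply: cvgM.
by case: ifP => _ //; exact: cvg_cst.
Qed.

Lemma cvg_sum_level_roots (C : numFieldType) (R : realType) (S : Type)
    (F : set_system S) (FF : Filter F) (f : C -> R) (n : nat)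
    (z : S -> nat -> C) (z0 : nat -> C) (v : S -> seq C) (u : seq C) :
  let p (x : nat -> C) := \prod_(k < n) ('X - (x k)%:P) in
  (forall x, {for x, continuous f}) ->
  (forall k, (fun s => z s k) @ F --> z0 k) ->
  (forall s, size (v s) = size u) ->
  (forall s, \prod_(y <- v s) ('X - y%:P) = p (z s) - ((p (z s)).[0])%:P) ->
  \prod_(y <- u) ('X - y%:P) = p z0 - ((p z0).[0])%:P ->
  (fun s => \sum_(y <- v s) f y) @ F --> \sum_(y <- u) f y.
Proof.
move=> p cf zz0 sz vE uE; apply: cvg_sum_roots => // j.
have coefE x : (p x - ((p x).[0])%:P)`_j = (p x)`_j - if j == 0%N then (p x).[0] else 0.
  by rewrite coefB coefC.
rewrite uE coefE; under eq_fun => s do rewrite vE coefE.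
apply: cvgB; first exact: cvg_coef_prod_XsubC.
case: ifP => _; last exact: cvg_cst.
have szp x : (size (p x) <= n.+1)%N.
  by rewrite size_prod_XsubC /index_enum -enumT size_enum_ord.
apply: (cvg_horner_coef FF (fun s => szp (z s)) (szp z0)) => k.
exact: cvg_coef_prod_XsubC.
Qed.

Lemma cvg_near_normC (C : numFieldType) (S : Type) (F : set_system S)
    (FF : Filter F) (x : S -> C) (y : C) :
  (forall e, 0 < e -> \forall s \near F, `|y - x s| < e) -> x @ F --> y.
Proof. by move=> xy; apply/cvgrPdist_lt. Qed.

Lemma continuous_near_normC (C : numFieldType) (R : realType) (f : C -> R) (x : C) :
  (forall e, 0 < e -> exists2 d, 0 < d & forall y, `|x - y| < d -> `|f x - f y| < e) ->
  {for x, continuous f}.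
Proof.
have := nbhs_filter x; move=> ? fx; apply/cvgrPdist_lt => e /fx[d d0 xd].
by exists d => //= y; exact: xd.
Qed.

(** The single [w s k] need not converge, since the solutions may be enumerated differently for each
    [s]; a symmetric sum does not see the enumeration. *)
Lemma cvg_sum_solutions (R : realType) (S : Type) (F : set_system S)
    (FF : Filter F) (f : R * R -> R) (n : nat) (z w : S -> nat -> R * R)
    (z0 w0 : nat -> R * R) :
  continuous f ->
  (forall k (e : R), 0 < e -> \forall s \near F, modulus (z0 k - z s k) < e) ->
  (forall s, solutions_of_level n (root_poly n (z s)) (w s)) ->
  solutions_of_level n (root_poly n z0) w0 ->
  (fun s => \sum_(0 <= k < n) f (w s k)) @ F --> \sum_(0 <= k < n) f (w0 k).
Proof.
move=> cf zz0 ws w0s; have [->|n0] := posnP n.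
  by rewrite big_geq//; under eq_fun do rewrite big_geq//; exact: cvg_cst.
have sumE (v : nat -> R * R) :
    \sum_(0 <= k < n) f (v k) = \sum_(y <- root_seq n v) f (of_C y).
  by rewrite big_map -iotaE; under [RHS]eq_bigr do rewrite to_CK.
rewrite sumE; under eq_fun do rewrite sumE.
apply: (@cvg_sum_level_roots R[i] R S F FF (fun y => f (of_C y)) n
  (fun s k => to_C (z s k)) (fun k => to_C (z0 k)) (fun s => root_seq n (w s))
  (root_seq n w0)) => [x|k|s|s|].
- apply: continuous_near_normC => e e0.
  have /cvgrPdist_lt/(_ e e0)/nbhs_ballP[d/= d0 xd] := cf (of_C x).
  exists d%:C%C => [|y]; first by rewrite ltcR.
  rewrite -{1}(of_CK x) -{1}(of_CK y) -to_CB normC_to_C ltcR => xy.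
  apply: xd; rewrite -ball_normE/=; apply: le_lt_trans xy.
  exact: ler_norm_modulus.
- apply: cvg_near_normC => e /gt0_realE[-> e0].
  near=> s; rewrite /= -to_CB normC_to_C ltcR; near: s; exact: zz0.
- by rewrite !size_root_seq.
- exact: solutions_root_poly.
- exact: solutions_root_poly.
Unshelve. all: by end_near.
Qed.

(** * Measurability of sums over the solutions *)

Lemma exists_solutions (R : realType) (n : nat) (z : nat -> R * R) : (0 < n)%N ->
  exists w : nat -> R * R, solutions_of_level n (root_poly n z) w.
Proof.
move=> n0; set p := root_poly n z.
have sz : size p = n.+1 by rewrite /p root_polyE size_prod_XsubC size_root_seq.
have sc : (size (- (p.[0])%:P) < size p)%N.
  by rewrite size_polyN sz ltnS (leq_trans (size_polyC_leq1 _)).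
have [r rE] := closed_field_poly_normal (p - (p.[0])%:P).
move: rE; rewrite lead_coefDl// /p root_polyE lead_coef_prod_XsubC scale1r.
rewrite -root_polyE -/p => rE.
have szr : size r = n.
  have := congr1 (fun q : {poly R[i]} => size q) rE.
  by rewrite /= size_polyDl// sz size_prod_XsubC => -[].
exists (fun k => of_C (nth 0 r k)) => x; rewrite rE mu_prod_XsubC.
rewrite -[in RHS](mkseq_nth 0 r) szr count_map -sum1_count.
rewrite iotaE big_mkord -sum1_card.
by apply: eq_bigl => k; rewrite inE of_CK.
Qed.

Lemma measurable_floor_eq d (T : measurableType d) (R : realType) (h : T -> R) (m : int) :
  measurable_fun setT h -> measurable [set t | Num.floor (h t) = m].
Proof.
move=> mh; rewrite (_ : mkset _ = h @^-1` `[m%:~R, (m + 1)%:~R[).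
  by rewrite -[X in measurable X]setTI; exact: mh.
apply/seteqP; split => t /=; rewrite in_itv/=.
  by move=> <-; exact: floor_itv.
exact: floor_def.
Qed.

Lemma measurable_discrete_factor d d' (T : measurableType d) (T' : measurableType d')
    (K : countType) (c : T -> K) (phi : K -> T') :
  (forall k, measurable [set t | c t = k]) -> measurable_fun setT (phi \o c).
Proof.
move=> mc _ Y mY; rewrite setTI.
rewrite (_ : _ @^-1` _ = \bigcup_k ([set t | c t = k] `&` [set t | Y (phi k)])).
  apply: countable_bigcupT_measurable => [|k]; first exact: countableP.
  have [yk|nyk] := pselect (Y (phi k)).
    by rewrite (_ : [set _ | Y _] = setT) ?setIT//; apply/seteqP; split.
  by rewrite (_ : [set _ | Y _] = set0) ?setI0//; apply/seteqP; split.
apply/seteqP; split => [t /= Yt|t [k _ [/= <-]]//].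
by exists (c t).
Qed.

Lemma floor_grid_close (R : realType) (x : R) (m : nat) :
  `|x - (Num.floor (x * m.+1%:R))%:~R / m.+1%:R| <= m.+1%:R^-1.
Proof.
have /andP[f1 f2] := floor_itv (x * m.+1%:R).
have m0 : 0 < m.+1%:R :> R by [].
rewrite ler_norml; apply/andP; split.
  by rewrite lerBrDl -lerBrDr opprK ler_wpDr ?invr_ge0// ler_pdivrMr.
by rewrite lerBlDr -[X in X + _]mul1r -mulrDl ler_pdivlMr// ltW// (lt_le_trans f2)// intrD addrC.
Qed.

(** The functions [w k] themselves may fail to be measurable. The sum is a pointwise limit: rounding
    the [z k] down to a grid of mesh [1 / (m + 1)] leaves countably many configurations, for each of
    which solutions [v] are chosen once and for all, and the sum depends continuously on the
    configuration. *)
Lemma measurable_sum_solutions d (T : measurableType d) (R : realType)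
    (f : R * R -> R) (n : nat) (z w : nat -> T -> R * R) :
  continuous f ->
  (forall k, measurable_fun setT (z k)) ->
  (forall t, solutions_of_level n (root_poly n (z ^~ t)) (w ^~ t)) ->
  measurable_fun setT (fun t => \sum_(0 <= k < n) f (w k t)).
Proof.
move=> cf mz sol; have [->|n0] := posnP n.
  by under eq_fun do rewrite big_geq//; exact: measurable_cst.
pose K := {ffun 'I_n -> int * int}.
pose code m t : K := [ffun k : 'I_n => (Num.floor ((z k t).1 * m.+1%:R),
                                        Num.floor ((z k t).2 * m.+1%:R))].
pose grid m (c : K) (k : nat) : R * R :=
  if insub k is Some i then ((c i).1%:~R / m.+1%:R, (c i).2%:~R / m.+1%:R) else 0.
have /choice[v vP] : forall mc : nat * K, exists v,
    solutions_of_level n (root_poly n (grid mc.1 mc.2)) v.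
  by move=> mc; exact: exists_solutions.
apply: (@measurable_fun_cvg _ _ _ _
  (fun m => (fun c => \sum_(0 <= k < n) f (v (m, c) k)) \o code m)) => [m|t _].
  apply: measurable_discrete_factor => c.
  rewrite (_ : mkset _ = \bigcap_(k in [set: 'I_n])
    ([set t | Num.floor ((z k t).1 * m.+1%:R) = (c k).1] `&`
     [set t | Num.floor ((z k t).2 * m.+1%:R) = (c k).2])).
    apply: fin_bigcap_measurable => // k _; apply: measurableI;
      apply: measurable_floor_eq; apply: measurable_funM => //;
      exact: measurableT_comp.
  apply/seteqP; split => [s /= <- k _|s /= sc]; first by rewrite ffunE.
  apply/ffunP => k; rewrite ffunE; have [/= -> ->] := sc k I.
  by case: (c k).
(* Convergence is required for every index [k], while [grid] returns 0 from [n] on; [z0] is cut in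
   the same way, which does not change the polynomial. *)
pose z0 k := if (k < n)%N then z k t else 0.
have z0E : root_poly n z0 = root_poly n (z ^~ t).
  by apply: eq_bigr => k _; rewrite /z0 ltn_ord.
apply: (@cvg_sum_solutions R nat \oo _ f n (fun m => grid m (code m t))
  (fun m => v (m, code m t)) z0 (w ^~ t)) => // [k e e0|m|].
- rewrite /z0; case: ltnP => kn; last first.
    near=> m; rewrite /grid insubN -?leqNgt//= subrr modulus0//.
  have e20 : 0 < 2^-1 * e by rewrite mulr_gt0.
  near=> m; rewrite /grid insubT/= !ffunE/=.
  apply: le_lt_trans (ler_modulus_norms _) _ => /=.
  apply: le_lt_trans (lerD (floor_grid_close _ _) (floor_grid_close _ _)) _.
  rewrite -mulr2n -[_ *+ 2]mulr_natl -ltr_pdivlMl//.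
  by near: m; exact: (near_infty_natSinv_lt (PosNum e20)).
- exact: vP.
- by rewrite z0E.
Unshelve. all: by end_near.
Qed.

(** * Law of large numbers *)

(** These functions are integrable for every probability measure and stable under sums and products,
    which settles the integrability conditions below. *)
Definition bounded_measurable d (T : measurableType d) (R : realType) (h : T -> R) :=
  measurable_fun setT h /\ exists M, forall x, `|h x| <= M.

Section bounded_measurable.
Context d (T : measurableType d) (R : realType).
Implicit Types (h k : T -> R) (P : probability T R).

Lemma bounded_measurable_cst (c : R) : bounded_measurable (fun _ : T => c).
Proof. by split; [exact: measurable_cst|exists `|c|]. Qed.

Lemma bounded_measurableD h k : bounded_measurable h -> bounded_measurable k ->
  bounded_measurable (fun x => h x + k x).
Proof.
move=> [mh [M hM]] [mk [N kN]]; split; first exact: measurable_funD.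
by exists (M + N) => x; rewrite (le_trans (ler_normD _ _))// lerD.
Qed.

Lemma bounded_measurableM h k : bounded_measurable h -> bounded_measurable k ->
  bounded_measurable (fun x => h x * k x).
Proof.
move=> [mh [M hM]] [mk [N kN]]; split; first exact: measurable_funM.
by exists (M * N) => x; rewrite normrM ler_pM.
Qed.

Lemma bounded_measurableB h k : bounded_measurable h -> bounded_measurable k ->
  bounded_measurable (fun x => h x - k x).
Proof.
move=> bh bk; under eq_fun do rewrite -mulN1r.
apply: bounded_measurableD => //; apply: bounded_measurableM => //.
exact: bounded_measurable_cst.
Qed.

Lemma bounded_measurable_sum (I : Type) (r : seq I) (h : I -> T -> R) :
  (forall i, bounded_measurable (h i)) ->
  bounded_measurable (fun x => \sum_(i <- r) h i x).
Proof.
move=> bh; elim: r => [|i r IH].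
  by under eq_fun do rewrite big_nil; exact: bounded_measurable_cst.
by under eq_fun do rewrite big_cons; exact: bounded_measurableD.
Qed.

Lemma bounded_measurable_comp d' (T' : measurableType d') h (phi : T' -> T) :
  measurable_fun setT phi -> bounded_measurable h ->
  bounded_measurable (fun x => h (phi x)).
Proof.
move=> mphi [mh [M hM]]; split; first exact: measurableT_comp.
by exists M.
Qed.

Lemma bounded_measurable_integrable P h : bounded_measurable h ->
  P.-integrable setT (EFin \o h).
Proof.
move=> [mh [M hM]]; apply: measurable_bounded_integrable => //.
  by rewrite (le_lt_trans (probability_le1 P measurableT)) ?ltry.
by exists M; split; [exact: num_real|move=> x Mx y _; exact: le_trans (hM y) (ltW Mx)].
Qed.

Lemma Rintegral_EFin P h : bounded_measurable h ->
  (\int[P]_x h x)%:E = (\int[P]_x (h x)%:E)%E.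
Proof.
move=> bh; rewrite /Rintegral fineK//.
exact: integrable_fin_num (bounded_measurable_integrable P bh).
Qed.

Lemma Rintegral_sum P (I : Type) (r : seq I) (h : I -> T -> R) :
  (forall i, bounded_measurable (h i)) ->
  \int[P]_x (\sum_(i <- r) h i x) = \sum_(i <- r) \int[P]_x h i x.
Proof.
move=> bh; elim: r => [|i r IH].
  under eq_fun do rewrite big_nil; rewrite big_nil Rintegral_cst//; exact: mul0r.
under eq_fun do rewrite big_cons; rewrite big_cons RintegralD ?IH//;
  apply: bounded_measurable_integrable => //; exact: bounded_measurable_sum.
Qed.

Lemma Rintegral_probability_cst P (c : R) : \int[P]_x c = c.
Proof. by rewrite Rintegral_cst// [X in fine X]probability_setT mulr1. Qed.

Lemma le_bounded_Rintegral P h k : bounded_measurable h -> bounded_measurable k ->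
  (forall x, h x <= k x) -> \int[P]_x h x <= \int[P]_x k x.
Proof.
by move=> bh bk hk; apply: le_Rintegral => // *; exact: bounded_measurable_integrable.
Qed.

Lemma Rintegral_image d' (T' : measurableType d') P (Q : probability T' R)
    (phi : T -> T') (h : T' -> R) :
  measurable_fun setT phi ->
  (forall A, measurable A -> P (phi @^-1` A) = Q A) ->
  measurable_fun setT h -> (exists M, forall x, `|h x| <= M) ->
  \int[P]_x h (phi x) = \int[Q]_y h y.
Proof.
move=> mphi PQ mh bh; rewrite /Rintegral; congr fine.
rewrite (@eq_measure_integral _ _ _ _ (pushforward P phi)); last first.
  by move=> A mA _; rewrite /= /pushforward PQ.
rewrite integral_pushforward//; last first.
  apply: (@bounded_measurable_integrable P (h \o phi)).
  by split; [exact: measurableT_comp|case: bh => M hM; exists M => x /=].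
exact/measurable_EFinP.
Qed.

End bounded_measurable.

Section high_probability.
Context d (T : measurableType d) (R : realType) (P : probability T R).

(* E n may fail to be measurable, so its failure is covered by a measurable set. *)
Definition with_high_probability (E : nat -> T -> Prop) :=
  forall delta : R, 0 < delta -> exists N, forall n, (N <= n)%N ->
    exists Bad, [/\ measurable Bad, (P Bad <= delta%:E)%E &
                    forall t, ~ Bad t -> E n t].

Lemma whp_impl (E F : nat -> T -> Prop) :
  (forall n t, (0 < n)%N -> E n t -> F n t) ->
  with_high_probability E -> with_high_probability F.
Proof.
move=> EF wE e e0; have [N NE] := wE e e0; exists N.+1 => n Nn.
have [Bad [mB PB BE]] := NE n (ltnW Nn); exists Bad; split=> // t /BE.
by apply: EF; apply: leq_ltn_trans Nn.
Qed.

Lemma whp_and (E F : nat -> T -> Prop) :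
  with_high_probability E -> with_high_probability F ->
  with_high_probability (fun n t => E n t /\ F n t).
Proof.
move=> wE wF e e0; have e20 : 0 < e / 2 by rewrite divr_gt0.
have [N NE] := wE _ e20; have [M MF] := wF _ e20.
exists (maxn N M) => n; rewrite geq_max => /andP[/NE[A [mA PA AE]] /MF[B [mB PB BF]]].
exists (A `|` B); split; first exact: measurableU.
  apply: le_trans (measureU2 _ mA mB) _.
  by rewrite (splitr e) EFinD leeD.
by move=> t /not_orP[/AE ? /BF ?].
Qed.

Lemma whp_all (I : eqType) (r : seq I) (E : I -> nat -> T -> Prop) :
  (forall i, i \in r -> with_high_probability (E i)) ->
  with_high_probability (fun n t => forall i, i \in r -> E i n t).
Proof.
elim: r => [|i r IH] wE.
  move=> e e0; exists 0%N => n _; exists set0; split=> //.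
  by rewrite measure0 lee_fin ltW.
have wr : with_high_probability (fun n t => forall j, j \in r -> E j n t).
  by apply: IH => j jr; apply: wE; rewrite inE jr orbT.
apply: whp_impl (whp_and (wE i (mem_head _ _)) wr) => n t _ [Ei Er] j.
by rewrite inE => /predU1P[->//|]; exact: Er.
Qed.

Lemma whp_ae (A : nat -> set T) :
  (forall k, measurable (A k)) -> (forall k, P (A k) = 0%E) ->
  with_high_probability (fun n t => forall k, ~ A k t).
Proof.
move=> mA PA e e0; exists 0%N => n _; exists (\bigcup_k A k); split.
- exact: bigcupT_measurable.
- have /(measure_negligible (bigcupT_measurable A mA)) -> : P.-negligible (\bigcup_k A k).
    by apply: negligible_bigcup => k; apply/negligibleP; [exact: mA|exact: PA].
  by rewrite lee_fin ltW.
- by move=> t At k Akt; apply: At; exists k.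
Qed.

Lemma markov_ge0 (f : T -> \bar R) (a : R) : measurable_fun setT f ->
  (forall t, 0 <= f t)%E -> 0 < a ->
  (a%:E * P [set t | a%:E <= f t] <= \int[P]_t f t)%E.
Proof.
move=> mf f0 a0.
have := @le_integral_comp_abse _ _ _ P _ measurableT f a id.
rewrite setTI (_ : [set x | _] = [set t | (a%:E <= f t)%E]); last first.
  by apply/seteqP; split => t /=; rewrite gee0_abs.
rewrite (eq_integral f) => [|t _]; last by rewrite gee0_abs.
by apply => // r s _ _.
Qed.

(* Chebyshev's inequality: only pairwise uncorrelatedness is used. *)
Lemma weak_law_of_large_numbers (X : nat -> T -> R) (M m : R) :
  (forall k, measurable_fun setT (X k)) -> (forall k t, `|X k t| <= M) ->
  (forall k, \int[P]_t X k t = m) ->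
  (forall i j, i != j -> \int[P]_t (X i t * X j t) = m * m) ->
  forall kappa : R, 0 < kappa ->
  with_high_probability (fun n t => `|n%:R^-1 * \sum_(0 <= k < n) X k t - m| <= kappa).
Proof.
move=> mX XM EX EXX kappa kappa0 e e0.
pose Y k t := X k t - m.
have bX k : bounded_measurable (X k) by split => //; exists M.
have bm := bounded_measurable_cst T m.
have bY k : bounded_measurable (Y k) by exact: bounded_measurableB.
have intb (h : T -> R) : bounded_measurable h -> P.-integrable setT (EFin \o h).
  exact: bounded_measurable_integrable.
have M0 : 0 <= M by rewrite (le_trans _ (XM 0%N point)).
have mM : `|m| <= M.
  rewrite -(EX 0%N) ler_norml; apply/andP; split.
    rewrite -(Rintegral_probability_cst P (- M)).
    apply: le_bounded_Rintegral => // [|t]; first exact: bounded_measurable_cst.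
    by have := XM 0%N t; rewrite ler_norml => /andP[].
  rewrite -[leRHS](Rintegral_probability_cst P).
  apply: le_bounded_Rintegral => // [|t]; first exact: bounded_measurable_cst.
  by have := XM 0%N t; rewrite ler_norml => /andP[].
have YM k t : `|Y k t| <= 2 * M.
  by rewrite (le_trans (ler_normB _ _))// mulr_natl mulr2n lerD.
have EYY i j : i != j -> \int[P]_t (Y i t * Y j t) = 0.
  move=> ij; have bXX : bounded_measurable (fun t => X i t * X j t).
    exact: bounded_measurableM.
  have bmX k : bounded_measurable (fun t => m * X k t) by exact: bounded_measurableM.
  have bmm : bounded_measurable (fun _ : T => m * m) by exact: bounded_measurable_cst.
  have -> : (fun t => Y i t * Y j t) = (fun t => (X i t * X j t - m * X i t) - (m * X j t - m * m)).
    by apply/funext => t; rewrite /Y; ring.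
  rewrite RintegralB//; [|by apply: intb; exact: bounded_measurableB..].
  rewrite !RintegralB//; [|exact: intb..].
  rewrite !RintegralZl//; [|exact: intb..].
  by rewrite !EX EXX// Rintegral_probability_cst; ring.
pose S n t := \sum_(0 <= k < n) Y k t.
have bS n : bounded_measurable (S n) by exact: bounded_measurable_sum.
(* The variance grows linearly: [S n] only involves indices below [n], so the cross term with [Y n]
   vanishes, and each new square is at most [(2 * M) ^+ 2]. *)
have ES2 n : \int[P]_t (S n t ^+ 2) <= n%:R * (2 * M) ^+ 2.
  elim: n => [|n IH].
    rewrite mul0r /S; under eq_fun do rewrite big_geq// expr0n/=.
    by rewrite Rintegral_probability_cst.
  have -> : (fun t => S n.+1 t ^+ 2) =
      (fun t => (S n t ^+ 2 + 2 * (S n t * Y n t)) + Y n t ^+ 2).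
    by apply/funext => t; rewrite /S big_nat_recr//=; ring.
  have bS2 : bounded_measurable (fun t => S n t ^+ 2).
    by under eq_fun do rewrite expr2; exact: bounded_measurableM.
  have bSY : bounded_measurable (fun t => S n t * Y n t) by exact: bounded_measurableM.
  have b2SY : bounded_measurable (fun t => 2 * (S n t * Y n t)).
    by apply: bounded_measurableM => //; exact: bounded_measurable_cst.
  have bY2 : bounded_measurable (fun t => Y n t ^+ 2).
    by under eq_fun do rewrite expr2; exact: bounded_measurableM.
  rewrite RintegralD//; [|by apply: intb; exact: bounded_measurableD|exact: intb].
  rewrite RintegralD//; [|exact: intb..].
  rewrite RintegralZl//; [|exact: intb].
  have -> : \int[P]_t (S n t * Y n t) = 0.
    under eq_fun do rewrite /S big_distrl/=.
    rewrite Rintegral_sum => [|k]; last exact: bounded_measurableM.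
    by rewrite big_nat big1// => k /andP[_ kn]; apply: EYY; rewrite neq_ltn kn.
  rewrite mulr0 addr0 -natr1 mulrDl mul1r lerD//.
  rewrite -(Rintegral_probability_cst P ((2 * M) ^+ 2)).
  apply: le_bounded_Rintegral => // [|t]; first exact: bounded_measurable_cst.
  rewrite -real_normK ?num_real// lerXn2r ?nnegrE//.
  by rewrite mulr_ge0.
(* Markov's inequality for [S n ^+ 2] at level [(n * kappa) ^+ 2] bounds the bad probability by
   [(2 * M) ^+ 2 / (n * kappa ^+ 2)]; this is at most [e] from [N] on. *)
have [N Nlt] : exists N : nat, (2 * M) ^+ 2 / (kappa ^+ 2 * e) < N%:R.
  exists (Num.truncn ((2 * M) ^+ 2 / (kappa ^+ 2 * e))).+1.
  by rewrite Num.Theory.truncnS_gt.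
exists N.+1 => n Nn; have n0 : 0 < n%:R :> R by rewrite ltr0n (leq_ltn_trans _ Nn).
have mS : measurable_fun setT (S n) by have [] := bS n.
exists [set t | (n%:R * kappa) ^+ 2 <= S n t ^+ 2]; split.
- rewrite -[X in measurable X]setTI.
  apply: (measurable_fun_le (f := cst _)) => //.
  by under eq_fun do rewrite expr2; exact: measurable_funM.
- have bS2 : bounded_measurable (fun t => S n t ^+ 2).
    by under eq_fun do rewrite expr2; exact: bounded_measurableM.
  have nk0 : 0 < (n%:R * kappa) ^+ 2 by rewrite exprn_gt0// mulr_gt0.
  have mS2 : measurable_fun setT (fun t => (S n t ^+ 2)%:E).
    by apply/measurable_EFinP; case: bS2.
  have := markov_ge0 mS2 _ nk0; rewrite -Rintegral_EFin//.
  rewrite -lee_pdivlMl// -EFinM => H; apply: le_trans (H _) _.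
    by move=> t; rewrite lee_fin sqr_ge0.
  rewrite lee_fin ler_pdivrMl// (le_trans (ES2 n))//.
  have -> : (n%:R * kappa) ^+ 2 * e = n%:R * (n%:R * (kappa ^+ 2 * e)) by ring.
  have ke0 : 0 < kappa ^+ 2 * e by rewrite mulr_gt0// exprn_gt0.
  rewrite ler_pM2l//; move: Nlt; rewrite ltr_pdivrMr// => /ltW/le_trans; apply.
  by rewrite ler_pM2r// ler_nat ltnW.
- move=> t /= /negP; rewrite -ltNge => lt.
  have -> : n%:R^-1 * (\sum_(0 <= k < n) X k t) - m = n%:R^-1 * S n t.
    rewrite /S /Y sumrB big_const_nat iter_addr_0 subn0 mulrBr; congr (_ - _).
    by rewrite -[m *+ n]mulr_natl mulKf ?gt_eqF.
  rewrite normrM gtr0_norm ?invr_gt0// ler_pdivrMl//.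
  rewrite -(@ler_pXn2r _ 2) ?nnegrE ?mulr_ge0 ?(ltW n0) ?(ltW kappa0)//.
  by rewrite real_normK ?num_real// ltW.
Qed.

End high_probability.

Section sample.
Context d d' (T : measurableType d) (T' : measurableType d') (R : realType).
Context (P : probability T R) (mu : probability T' R) (z : nat -> {RV P >-> T'}).
Hypothesis z_distribution : forall k A, measurable A -> distribution P (z k) A = mu A.
Hypothesis z_independent : mutually_independent P z.

Lemma joint_distribution (i j : nat) (A : set (T' * T')) : i != j -> measurable A ->
  P ((fun t => (z i t, z j t)) @^-1` A) = (mu \x mu)%E A.
Proof.
move=> ij mA.
have mz : measurable_fun setT (fun t => (z i t, z j t)).
  by apply/measurable_fun_pairP; split; exact: measurable_funPT.
apply/esym; rewrite -[RHS]/(pushforward P (fun t => (z i t, z j t)) A).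
apply: (product_measure_unique (m' := pushforward P (fun t => (z i t, z j t)))) => //.
move=> B C mB mC; rewrite /pushforward.
(* Independence is stated for a whole family of events; this family realises the rectangle [B x C]
   on the indices [i] and [j]. *)
pose D k := if k == i then B else C.
have mD k : measurable (D k) by rewrite /D; case: ifP.
have := z_independent (s := [:: i; j]) (A := D) _ mD.
rewrite /= inE ij => /(_ isT).
rewrite !big_cons big_nil mule1 /D eqxx eq_sym (negbTE ij) => zE.
rewrite -(z_distribution i mB) -(z_distribution j mC) -zE; congr (P _).
apply/seteqP; split => t /=.
  by move=> [Bt Ct] k /=; rewrite !inE => /orP[] /eqP ->; rewrite ?eqxx// eq_sym (negbTE ij).
move=> H; split.
  by have := H i; rewrite /= inE eqxx; exact.
by have := H j; rewrite /= !inE eqxx orbT eq_sym (negbTE ij); exact.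
Qed.

Lemma Rintegral_sample (k : nat) (h : T' -> R) : bounded_measurable h ->
  \int[P]_t h (z k t) = \int[mu]_x h x.
Proof.
move=> [mh bh]; apply: Rintegral_image => // A mA.
exact: z_distribution.
Qed.

Lemma Rintegral_sampleM (i j : nat) (h : T' -> R) : i != j -> bounded_measurable h ->
  \int[P]_t (h (z i t) * h (z j t)) = (\int[mu]_x h x) * (\int[mu]_x h x).
Proof.
move=> ij bh; have [mh [M hM]] := bh.
have mz : measurable_fun setT (fun t => (z i t, z j t)).
  by apply/measurable_fun_pairP; split; exact: measurable_funPT.
pose H (x : T' * T') := h x.1 * h x.2.
have bH : bounded_measurable H.
  by apply: bounded_measurableM; exact: bounded_measurable_comp.
rewrite (@Rintegral_image _ _ _ _ _ P (mu \x mu)%E (fun t => (z i t, z j t)) H)//; first last.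
- by case: bH.
- by case: bH.
- by move=> A mA; exact: joint_distribution.
apply: EFin_inj; rewrite EFinM !Rintegral_EFin// -integral12_prod_meas1; last first.
  exact: bounded_measurable_integrable bH.
rewrite (eq_integral (fun x => (\int[mu]_y (h y)%:E) * (h x)%:E)%E) => [|x _].
  rewrite -Rintegral_EFin// integralZl ?Rintegral_EFin//.
  exact: (bounded_measurable_integrable mu bh).
rewrite /fubini_F (eq_integral (fun y => (h x)%:E * (h y)%:E)%E)//.
rewrite integralZl//; last exact: bounded_measurable_integrable bh.
by rewrite muleC.
Qed.

Lemma sample_law_of_large_numbers (h : T' -> R) (kappa : R) :
  bounded_measurable h -> 0 < kappa ->
  with_high_probability P (fun n t =>
    `|n%:R^-1 * \sum_(0 <= k < n) h (z k t) - \int[mu]_x h x| <= kappa).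
Proof.
move=> bh kappa0; have [mh [M hM]] := bh.
apply: (weak_law_of_large_numbers (M := M)) => // [k|k|i j ij].
- exact: measurableT_comp.
- exact: Rintegral_sample.
- exact: Rintegral_sampleM.
Qed.

End sample.

(** * Rotation invariance of plane Lebesgue measure *)

Section lebesgue_plane.
Variable R : realType.
Notation MR := (measurableTypeR R).
Notation lambda := (@lebesgue_measure R).

Lemma lebesgue_measure_translate (c : R) (A : set MR) : measurable A ->
  lambda [set x : MR | A (x + c)] = lambda A.
Proof.
move=> mA; have mt : measurable_fun setT ((fun x : MR => x + c) : MR -> MR).
  by apply: measurable_funD => //; exact: measurable_cst.
apply/esym.
apply: (@lebesgue_measure_unique R (pushforward lambda (fun x : MR => x + c : MR))) => //.
move=> _ [[a b]] _ <-.
transitivity (lambda `]a - c, b - c]); last first.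
  rewrite /= /pushforward; congr (lambda _); apply/seteqP.
  by split => x /=; rewrite !in_itv/= ltrBlDr lerBrDr.
by rewrite !lebesgue_measure_itv/= !lte_fin ltrD2r -!EFinB; case: ifP => // _; congr EFin; ring.
Qed.

Lemma lebesgue2X (A B : set MR) : measurable A -> measurable B ->
  lebesgue2 R (A `*` B) = (lambda A * lambda B)%E.
Proof. exact: product_measure1E. Qed.

Lemma lebesgue2_unique (m : {measure set (MR * MR) -> \bar R}) :
  (forall A B, measurable A -> measurable B -> m (A `*` B) = (lambda A * lambda B)%E) ->
  forall X, measurable X -> lebesgue2 R X = m X.
Proof. exact: product_measure_unique. Qed.

Lemma lebesgue2_section2 (A : set (MR * MR)) : measurable A ->
  lebesgue2 R A = (\int[lambda]_y lambda (ysection A y))%E.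
Proof.
move=> mA; rewrite (lebesgue2_unique (m := (lambda \x^ lambda)%E))//.
by move=> B C mB mC; exact: product_measure2E.
Qed.

(** The horizontal sections of the preimage of a rectangle are translates of one set, so integrating
    over [y] last gives the measure of the rectangle; uniqueness of the product measure does the
    rest. *)
Lemma lebesgue2_shear1 (a : R) (A : set (MR * MR)) : measurable A ->
  lebesgue2 R [set u : MR * MR | A (u.1 + a * u.2, u.2)] = lebesgue2 R A.
Proof.
pose f (u : MR * MR) : MR * MR := (u.1 + a * u.2, u.2).
have mf : measurable_fun setT f.
  apply/measurable_fun_pairP; split => /=; last exact: measurable_snd.
  apply: measurable_funD; first exact: measurable_fst.
  by apply: measurable_funM; [exact: measurable_cst|exact: measurable_snd].
move=> mA; apply/esym; apply: (lebesgue2_unique (m := pushforward (lebesgue2 R) f)) => //.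
move=> {A mA} A B mA mB; rewrite -[LHS]/(lebesgue2 R (f @^-1` (A `*` B))).
rewrite lebesgue2_section2; last first.
  by rewrite -[X in measurable X]setTI; apply: mf => //; exact: measurableX.
rewrite (eq_integral (fun y => (lambda A) * (\1_B y)%:E)%E) => [|y _].
  rewrite ge0_integralZl//; last by apply/measurable_EFinP; exact: measurable_indic.
  by rewrite integral_indic// setIT.
rewrite indicE; have [By|nBy] := boolP (y \in B).
  rewrite mule1 -(lebesgue_measure_translate (a * y) mA); congr (lambda _).
  apply/seteqP; split => x; rewrite /ysection/= inE/=; first by case.
  by move=> Ax; split=> //; exact: set_mem.
rewrite mule0 (_ : ysection _ _ = set0) ?measure0//.
apply/seteqP; split => x //=; rewrite /ysection/= inE => -[_ /= yB].
by move: nBy; rewrite notin_setE.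
Qed.

Lemma lebesgue2_section1 (A : set (MR * MR)) :
  lebesgue2 R A = (\int[lambda]_x lambda (xsection A x))%E.
Proof. by []. Qed.

Lemma lebesgue2_shear2 (a : R) (A : set (MR * MR)) : measurable A ->
  lebesgue2 R [set u : MR * MR | A (u.1, u.2 + a * u.1)] = lebesgue2 R A.
Proof.
pose f (u : MR * MR) : MR * MR := (u.1, u.2 + a * u.1).
have mf : measurable_fun setT f.
  apply/measurable_fun_pairP; split => /=; first exact: measurable_fst.
  apply: measurable_funD; first exact: measurable_snd.
  by apply: measurable_funM; [exact: measurable_cst|exact: measurable_fst].
move=> mA; apply/esym; apply: (lebesgue2_unique (m := pushforward (lebesgue2 R) f)) => //.
move=> {A mA} A B mA mB; rewrite -[LHS]/(lebesgue2 R (f @^-1` (A `*` B))).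
rewrite lebesgue2_section1.
rewrite (eq_integral (fun x => (lambda B) * (\1_A x)%:E)%E) => [|x _].
  rewrite ge0_integralZl//; last by apply/measurable_EFinP; exact: measurable_indic.
  by rewrite integral_indic// setIT muleC.
rewrite indicE; have [Ax|nAx] := boolP (x \in A).
  rewrite mule1 -(lebesgue_measure_translate (a * x) mB); congr (lambda _).
  apply/seteqP; split => y; rewrite /xsection/= inE/=; first by case.
  by move=> By; split=> //; exact: set_mem.
rewrite mule0 (_ : xsection _ _ = set0) ?measure0//.
apply/seteqP; split => y //=; rewrite /xsection/= inE => -[/= Ax _].
by move: nAx; rewrite notin_setE.
Qed.

Definition rotation (c s : R) (u : R * R) : R * R :=
  (c * u.1 - s * u.2, s * u.1 + c * u.2).

Lemma measurable_rotation (c s : R) : measurable_fun setT (rotation c s).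
Proof.
apply/measurable_fun_pairP; split => /=.
  by apply: measurable_funB; apply: measurable_funM.
by apply: measurable_funD; apply: measurable_funM.
Qed.

(** A rotation with [s != 0] is the product of three shears, with coefficients [t], [s], [t] where
    [t = (c - 1) / s]. If [s = 0] it is the identity or the half-turn, which is the square of a
    quarter-turn. *)
Lemma lebesgue2_rotation (c s : R) (A : set (MR * MR)) : c ^+ 2 + s ^+ 2 = 1 ->
  measurable A -> lebesgue2 R [set u : MR * MR | A (rotation c s u)] = lebesgue2 R A.
Proof.
have mrot (a b : R) (B : set (MR * MR)) : measurable B ->
    measurable [set u : MR * MR | B (rotation a b u)].
  by move=> mB; rewrite -[X in measurable X]setTI; exact: measurable_rotation.
have rot (a b : R) (B : set (MR * MR)) : a ^+ 2 + b ^+ 2 = 1 -> b != 0 ->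
    measurable B -> lebesgue2 R [set u : MR * MR | B (rotation a b u)] = lebesgue2 R B.
  move=> ab1 b0 mB; pose t := (a - 1) / b.
  have m1 (C : set (MR * MR)) (k : R) : measurable C ->
      measurable [set u : MR * MR | C (u.1 + k * u.2, u.2)].
    move=> mC; rewrite -[X in measurable X]setTI.
    apply: (_ : measurable_fun setT (fun u : MR * MR => (u.1 + k * u.2, u.2) : MR * MR)) => //.
    apply/measurable_fun_pairP; split => /=; last exact: measurable_snd.
    apply: measurable_funD; first exact: measurable_fst.
    by apply: measurable_funM; [exact: measurable_cst|exact: measurable_snd].
  have m2 (C : set (MR * MR)) (k : R) : measurable C ->
      measurable [set u : MR * MR | C (u.1, u.2 + k * u.1)].
    move=> mC; rewrite -[X in measurable X]setTI.
    apply: (_ : measurable_fun setT (fun u : MR * MR => (u.1, u.2 + k * u.1) : MR * MR)) => //.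
    apply/measurable_fun_pairP; split => /=; first exact: measurable_fst.
    apply: measurable_funD; first exact: measurable_snd.
    by apply: measurable_funM; [exact: measurable_cst|exact: measurable_fst].
  rewrite -(lebesgue2_shear1 t mB) -(lebesgue2_shear2 b (m1 _ t mB)).
  rewrite -(lebesgue2_shear1 t (m2 _ b (m1 _ t mB))); congr (lebesgue2 R _).
  have tb : t * b = a - 1 by rewrite mulfVK.
  have ta : t * (1 + a) = - b.
    apply: (mulIf b0); rewrite mulrAC tb.
    have -> : (a - 1) * (1 + a) = a ^+ 2 - 1 by ring.
    by rewrite -ab1; ring.
  have tb' : 1 + t * b = a by rewrite tb; ring.
  apply/funext => -[x y] /=; congr (B (_, _)) => /=.
    transitivity (x * (1 + t * b) + y * (t * (1 + (1 + t * b)))); last by ring.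
    by rewrite tb' ta; ring.
  transitivity (y * (1 + t * b) + b * x); last by ring.
  by rewrite tb'; ring.
move=> cs1 mA; have [s0|] := eqVneq s 0; last by move=> ?; exact: rot.
move: cs1; rewrite s0 expr0n/= addr0 => /eqP; rewrite sqrf_eq1 => /orP[/eqP->|/eqP->].
  congr (lebesgue2 R _); apply/funext => -[x y]; congr (A _).
  by rewrite /rotation/= !mul1r !mul0r subr0 add0r.
have r01 : (0 : R) ^+ 2 + 1 ^+ 2 = 1 by rewrite expr0n/= add0r expr1n.
rewrite -(rot 0 1 A r01 (oner_neq0 _) mA) -(rot 0 1 _ r01 (oner_neq0 _) (mrot 0 1 _ mA)).
congr (lebesgue2 R _); apply/funext => -[x y]; congr (A _).
by rewrite /rotation/=; congr (_, _); ring.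
Qed.

End lebesgue_plane.

(** * Measures with a continuous radial density *)

(** The plane carries the product sigma-algebra. A continuous function is the limit of its values at
    rounded points, and these approximations factor through a countable set. *)
Lemma measurable_fun_continuous_plane (R : realType) (f : R * R -> R) :
  continuous f -> measurable_fun setT f.
Proof.
move=> cf.
pose code m (u : R * R) := (Num.floor (u.1 * m.+1%:R), Num.floor (u.2 * m.+1%:R)).
pose grid m (c : int * int) : R * R := (c.1%:~R / m.+1%:R, c.2%:~R / m.+1%:R).
apply: (@measurable_fun_cvg _ _ _ _ (fun m => (fun c => f (grid m c)) \o code m)) => [m|u _].
  apply: measurable_discrete_factor => -[a b].
  rewrite (_ : mkset _ = [set u | Num.floor (u.1 * m.+1%:R) = a] `&`
                         [set u | Num.floor (u.2 * m.+1%:R) = b]).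
    apply: measurableI; apply: measurable_floor_eq; apply: measurable_funM => //.
  by apply/seteqP; split => [t [<- <-]//|t /= [<- <-]].
apply: (cvg_comp (fun m => grid m (code m u)) f) (cf u).
apply/cvgrPdist_lt => e e0; near=> m.
rewrite prod_normE gt_max/=.
have me : m.+1%:R^-1 < e by near: m; exact: (near_infty_natSinv_lt (PosNum e0)).
by rewrite !(le_lt_trans (floor_grid_close _ _)).
Unshelve. all: by end_near.
Qed.

Lemma same_floor_close (R : realType) (x y : R) (m : nat) :
  Num.floor (x * m.+1%:R) = Num.floor (y * m.+1%:R) -> `|x - y| < m.+1%:R^-1.
Proof.
move=> xy; have /andP[x1 x2] := floor_itv (x * m.+1%:R).
have /andP[y1 y2] := floor_itv (y * m.+1%:R).
rewrite -[ltRHS]mul1r ltr_pdivlMr// -{1}(@ger0_norm _ m.+1%:R)// -normrM mulrBl.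
by move: x1 x2; rewrite xy intrD ltr_norml => x1 x2; apply/andP; split; lra.
Qed.

Lemma measurable_open_plane (R : realType) (U : set (R * R)) : open U -> measurable U.
Proof.
move=> oU.
pose box (mc : nat * (int * int)) : set (R * R) :=
  [set u | Num.floor (u.1 * mc.1.+1%:R) = mc.2.1] `&`
  [set u | Num.floor (u.2 * mc.1.+1%:R) = mc.2.2].
rewrite (_ : U = \bigcup_mc (if pselect (box mc `<=` U) then box mc else set0)).
  apply: countable_bigcupT_measurable => [|mc]; first exact: countableP.
  case: pselect => [?|?]; last exact: measurable0.
  apply: measurableI; apply: measurable_floor_eq;
    exact: measurable_funM.
apply/seteqP; split => u; last first.
  by move=> [mc _]; case: pselect => // boxU; exact: boxU.
move=> Uu; have /nbhs_ballP[e/= e0 eU] : nbhs u U by exact: open_nbhs_nbhs.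
have [m _ /(_ m (leqnn m))/= me] := near_infty_natSinv_lt (PosNum e0).
exists (m, (Num.floor (u.1 * m.+1%:R), Num.floor (u.2 * m.+1%:R))) => //.
case: pselect => [?|]; first by [].
case=> v [/= v1 v2]; apply: eU; split; rewrite -ball_normE/=;
  exact: lt_trans (same_floor_close (esym _)) me.
Qed.

Lemma measurable_lt_fun d (T : measurableType d) (R : realType) (f h : T -> R) :
  measurable_fun setT f -> measurable_fun setT h -> measurable [set x | f x < h x].
Proof.
move=> mf mh; rewrite (_ : mkset _ = (fun x => f x < h x) @^-1` [set true])//.
by rewrite -[X in measurable X]setTI; exact: measurable_fun_ltr.
Qed.

Lemma measurable_eq_fun d (T : measurableType d) (R : realType) (f h : T -> R) :
  measurable_fun setT f -> measurable_fun setT h -> measurable [set x | f x = h x].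
Proof.
move=> mf mh; rewrite (_ : mkset _ = (fun x => f x == h x) @^-1` [set true]).
  by rewrite -[X in measurable X]setTI; exact: measurable_fun_eqr.
by apply/seteqP; split => x /=; [move=> ->; exact: eqxx|move/eqP].
Qed.

Section density.
Context (R : realType) (mu : probability (R * R)%type R) (g : R * R -> R).
Hypothesis mu_compact : compact (msupport mu).
Hypothesis g_density : has_density mu g.
Hypothesis g_continuous : continuous g.
Hypothesis g_radial : radial g.
Notation MR := (measurableTypeR R).
Notation lambda := (@lebesgue_measure R).

Let g0 u : 0 <= g u. Proof. by case: g_density. Qed.
Let muE A : measurable A -> mu A = (\int[lebesgue2 R]_(u in A) (g u)%:E)%E.
Proof. by case: g_density => _; exact. Qed.
Let mg : measurable_fun setT (g : MR * MR -> R).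
Proof. exact: measurable_fun_continuous_plane. Qed.

(** Around [u] the density stays above [g u / 2] on a small square inside the given neighbourhood.
    Contrapositively, [g] vanishes off the compact support of [mu]; this is how [g] is seen to be
    bounded with bounded support. *)
Lemma density_msupport u : g u != 0 -> msupport mu u.
Proof.
move=> gu U [oU Uu].
have gu0 : 0 < g u by rewrite lt0r gu g0.
have g20 : 0 < g u / 2 by rewrite divr_gt0.
have /nbhs_ballP[e1/= e10 e1U] : nbhs u U by exact: open_nbhs_nbhs.
have /cvgrPdist_lt/(_ _ g20)/nbhs_ballP[e2/= e20 e2g] := @g_continuous u.
pose e := Num.min e1 e2.
have e0 : 0 < e by rewrite lt_min e10.
have ee1 : e <= e1 by rewrite ge_min lexx.
have ee2 : e <= e2 by rewrite ge_min lexx orbT.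
pose D : set (MR * MR) := ball u.1 e `*` ball u.2 e.
have mD : measurable D by apply: measurableX; exact: measurable_ball.
have DU : D `<=` U.
  by move=> v [/= v1 v2]; apply: e1U; split; apply: (le_ball ee1).
have Dg v : D v -> g u / 2 <= g v.
  move=> [/= v1 v2]; have : `|g u - g v| < g u / 2.
    by apply: e2g; split; apply: (le_ball ee2).
  rewrite ltr_norml => /andP[_]; lra.
have : (0 < mu D)%E.
  rewrite muE//; apply: (@lt_le_trans _ _ ((g u / 2)%:E * lebesgue2 R D)%E).
    rewrite mule_gt0 ?lte_fin// lebesgue2X; [|exact: measurable_ball..].
    by rewrite !lebesgue_measure_ball ?ltW// -EFinM lte_fin mulr_gt0// mulrn_wgt0.
  rewrite -integral_cst//; apply: ge0_le_integral => //.
  - by move=> x _; rewrite lee_fin ltW.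
  - by apply/measurable_EFinP; exact: measurable_funTS.
move=> /lt_le_trans; apply; apply: le_measure; rewrite ?inE//.
exact: measurable_open_plane.
Qed.

Lemma density_bounds : exists B C : R, [/\ 0 < B, 0 <= C, forall u, g u <= C &
  forall u, g u != 0 -> [/\ ball 0 B u.1, ball 0 B u.2 & modulus u <= B]].
Proof.
have [M [_ Mb]] := compact_bounded mu_compact.
have [N [_ Nb]] : bounded_set (g @` msupport mu).
  apply: compact_bounded; apply: continuous_compact => //.
  exact: continuous_subspaceT.
pose M1 := `|M| + 1; pose N1 := `|N| + 1.
have M1b u : g u != 0 -> `|u| <= M1.
  by move=> /density_msupport; apply: Mb; rewrite /M1 ltr_pwDr// ler_norm.
exists (2 * M1 + 1), N1; split => [|||u gu].
- by rewrite addr_gt0// mulr_gt0// ltr_wpDl.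
- by rewrite addr_ge0.
- move=> u; have [->|/density_msupport su] := eqVneq (g u) 0; first by rewrite addr_ge0.
  rewrite (le_trans (ler_norm _))//; apply: (Nb N1); last by exists u.
  by rewrite /N1 ltr_pwDr// ler_norm.
have := M1b _ gu; rewrite prod_normE ge_max => /andP[u1 u2].
have M10 : 0 <= M1 by rewrite (le_trans _ (M1b _ gu)).
split; rewrite -?ball_normE/= ?sub0r ?normrN; [lra..|].
have := ler_modulus_norm u; have := M1b _ gu; lra.
Qed.

(** The bounds on [mu] that follow come from here: [D] is empty for the outside of a large ball, a
    rectangle for a strip, and the circle itself for a circle. *)
Lemma mu_le_lebesgue2 (C : R) (A D : set (MR * MR)) : 0 <= C ->
  (forall u, g u <= C) -> measurable A -> measurable D ->
  (forall u, A u -> g u != 0 -> D u) -> (mu A <= C%:E * lebesgue2 R D)%E.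
Proof.
move=> C0 gC mA mD AD; rewrite muE//.
rewrite -integral_cst// [leLHS]integral_mkcond [leRHS]integral_mkcond.
apply: ge0_le_integral => //.
- by move=> u _; rewrite patchE; case: ifP => // _; rewrite lee_fin.
- apply/(measurable_restrictT _ mA)/measurable_EFinP.
  exact: measurable_funTS.
- apply/(measurable_restrictT _ mD).
  exact: measurable_cst.
- move=> u _; rewrite !patchE.
  have [uA|uA] := boolP (u \in A); have [uD|uD] := boolP (u \in D); rewrite ?lee_fin//.
  have [->//|gu] := eqVneq (g u) 0.
  by move: uD; rewrite notin_setE => /(_ (AD _ (set_mem uA) gu)).
Qed.

Lemma mu_outside_ball : exists2 B : R, 0 < B & mu [set u | B < modulus u] = 0%E.
Proof.
have [B [C [B0 C0 gC gB]]] := density_bounds; exists B => //.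
apply/eqP; rewrite -measure_le0.
rewrite -(mule0 C%:E) -(measure0 (lebesgue2 R)).
apply: mu_le_lebesgue2 => // [|u /= Bu gu].
  apply: measurable_lt_fun => //.
  by apply: measurable_fun_continuous_plane; exact: modulus_continuous.
by have [_ _] := gB _ gu; rewrite leNgt Bu.
Qed.

(** Where [g] is nonzero, a strip of half-width [delta] lies in a rectangle of sides [2 delta] and
    [2 B], whose area times the bound [C] of [g] is [K * delta]. *)
Lemma mu_strips : exists2 K : R, 0 <= K & forall a delta : R, 0 < delta ->
  (mu [set u : R * R | (`|u.1 - a| < delta)%R] <= (K * delta)%:E)%E /\
  (mu [set u : R * R | (`|u.2 - a| < delta)%R] <= (K * delta)%:E)%E.
Proof.
have [B [C [B0 C0 gC gB]]] := density_bounds; exists (C * (B *+ 2) * 2).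
  by rewrite !mulr_ge0// mulrn_wge0// ltW.
move=> a e e0.
have -> : ((C * (B *+ 2) * 2 * e)%:E = C%:E * ((e *+ 2)%:E * (B *+ 2)%:E))%E.
  by rewrite -!EFinM; congr EFin; ring.
rewrite -(lebesgue_measure_ball a (ltW e0)) -(lebesgue_measure_ball 0 (ltW B0)).
have mb (b r : R) : measurable (ball b r : set MR) by exact: measurable_ball.
split; [|rewrite [X in (_ <= _ * X)%E]muleC]; rewrite -lebesgue2X//;
  apply: mu_le_lebesgue2 => //.
- apply: measurable_lt_fun => //.
  by apply: measurableT_comp => //; apply: measurable_funB => //; exact: measurable_cst.
- exact: measurableX.
- by move=> u /= ua /gB[_ u2 _]; split => //; rewrite -ball_normE/= distrC.
- apply: measurable_lt_fun => //.
  by apply: measurableT_comp => //; apply: measurable_funB => //; exact: measurable_cst.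
- exact: measurableX.
- by move=> u /= ua /gB[u1 _ _]; split => //; rewrite -ball_normE/= distrC.
Qed.

(** A vertical line meets a circle in at most two points, so every section is Lebesgue null. *)
Lemma mu_circle (r : R) : mu [set u | modulus u = r] = 0%E.
Proof.
have [B [C [B0 C0 gC gB]]] := density_bounds.
have mc : measurable [set u : MR * MR | modulus u = r].
  apply: measurable_eq_fun => //.
  by apply: measurable_fun_continuous_plane; exact: modulus_continuous.
apply/eqP; rewrite -measure_le0.
rewrite (le_trans (mu_le_lebesgue2 (D := [set u | modulus u = r]) C0 gC mc mc _))//.
rewrite lebesgue2_section1 integral0_eq ?mule0// => x _.
apply: countable_lebesgue_measure0.
apply: (@sub_countable _ _ _ [set Num.sqrt (r ^+ 2 - x ^+ 2); - Num.sqrt (r ^+ 2 - x ^+ 2)]).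
  apply: subset_card_le => y; rewrite /xsection/= inE/= => xy.
  have : y ^+ 2 == Num.sqrt (r ^+ 2 - x ^+ 2) ^+ 2.
    have -> : r ^+ 2 - x ^+ 2 = y ^+ 2.
      by rewrite -xy /modulus/= sqr_sqrtr ?addr_ge0 ?sqr_ge0// addrC addKr.
    by rewrite sqr_sqrtr ?sqr_ge0.
  by rewrite eqf_sqr => /orP[/eqP->|/eqP->]; [left|right].
by apply: finite_set_countable; exact: finite_set2.
Qed.

Lemma mu_rotation (c s : R) (A : set (R * R)) : c ^+ 2 + s ^+ 2 = 1 ->
  measurable A -> mu (rotation c s @^-1` A) = mu A.
Proof.
move=> cs1 mA.
have mrA : measurable (rotation c s @^-1` A).
  by rewrite -[X in measurable X]setTI; exact: measurable_rotation.
rewrite !muE//.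
transitivity (\int[lebesgue2 R]_(u in rotation c s @^-1` A) ((EFin \o g) (rotation c s u)))%E.
  apply: eq_integral => u _ /=; congr EFin; apply: g_radial.
  rewrite !normC_to_C /modulus/=; congr (Num.sqrt _)%:C%C.
  transitivity ((c ^+ 2 + s ^+ 2) * (u.1 ^+ 2 + u.2 ^+ 2)); last by ring.
  by rewrite cs1 mul1r.
have mr : measurable_fun setT (rotation c s : MR * MR -> MR * MR).
  exact: measurable_rotation.
have pE : (\int[pushforward (lebesgue2 R) (rotation c s : MR * MR -> MR * MR)]_(u in A) (g u)%:E =
    \int[lebesgue2 R]_(u in rotation c s @^-1` A) ((EFin \o g) (rotation c s u)))%E.
  apply: (ge0_integral_pushforward mr) => //.
  - by apply/measurable_EFinP; exact: measurable_funTS.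
  - by move=> u _; rewrite lee_fin.
transitivity (\int[pushforward (lebesgue2 R) (rotation c s : MR * MR -> MR * MR)]_(u in A)
    (g u)%:E)%E.
  exact: esym pE.
by apply: eq_measure_integral => D mD _; exact: lebesgue2_rotation.
Qed.

End density.

(** * The logarithmic potential *)

(** The factorisation of [X^m - 1] made homogeneous: it is evaluated at [a / b] and multiplied by
    [b ^+ m], the case [b = 0] being treated apart. *)
Lemma prod_sub_unity_roots (F : closedFieldType) (m : nat) : (0 < m)%N ->
  exists r : seq F, size r = m /\
    (forall x, x \in r -> x ^+ m = 1) /\
    (forall a b : F, \prod_(x <- r) (a - x * b) = a ^+ m - b ^+ m).
Proof.
move=> m0; have [r rE] := closed_field_poly_normal ('X^m - 1 : {poly F}).
move: rE; rewrite lead_coefXnsubC// scale1r => rE; exists r.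
have szr : size r = m.
  have := congr1 (fun q : {poly F} => size q) rE.
  by rewrite /= size_XnsubC// size_prod_XsubC => -[].
split=> //; split=> [x xr|a b].
  have : root ('X^m - 1) x by rewrite rE root_prod_XsubC.
  by rewrite /root !hornerE subr_eq0 => /eqP.
have [->|b0] := eqVneq b 0.
  rewrite expr0n gtn_eqF// subr0 -szr.
  under eq_bigr do rewrite mulr0 subr0.
  by rewrite big_const_seq count_predT iter_mulr_1.
have := congr1 (fun q : {poly F} => q.[a / b] * b ^+ m) rE.
rewrite /= !hornerE mulrBl mul1r expr_div_n divfK ?expf_neq0// => ->.
rewrite horner_prod -szr -(iter_mulr_1 (size r)) -count_predT -big_const_seq.
rewrite -big_split/=; apply: eq_bigr => x _.
by rewrite hornerXsubC mulrBl divfK.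
Qed.

Section log_max.
Variable R : realType.
Implicit Types (r s k : R) (u v w z : R * R).

(** The logarithm cut off below at [ln r], which makes it Lipschitz with constant [1 / r]. *)
Definition lnmax r (x : R) : R := ln (Num.max x r).

Lemma max_gt0r (x r : R) : 0 < r -> 0 < Num.max x r.
Proof. by move=> r0; rewrite lt_max r0 orbT. Qed.

Lemma ln_dist_le (a b : R) k : 0 < a -> 0 < b -> a <= k * b -> b <= k * a ->
  `|ln a - ln b| <= ln k.
Proof.
move=> a0 b0 ab ba.
have k0 : 0 < k by rewrite -(pmulr_lgt0 _ b0) (lt_le_trans a0).
rewrite ler_norml lerBlDr -lnM ?posrE// lerNl opprB lerBlDr -lnM ?posrE//.
by rewrite !ler_ln ?posrE ?mulr_gt0// ab ba.
Qed.

Lemma ln_le_sub1 (x : R) : 0 < x -> ln x <= x - 1.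
Proof.
move=> x0; have := @le_ln1Dx R (x - 1); rewrite subrKC; apply.
by rewrite ltrBrDl subrr.
Qed.

Lemma lnmax_lipschitz r (x y : R) : 0 < r -> `|lnmax r x - lnmax r y| <= `|x - y| / r.
Proof.
move=> r0; wlog xy : x y / y <= x.
  move=> H; have [/H//|/ltW/H] := leP y x.
  by rewrite distrC [`|y - x|]distrC.
have my := max_gt0r y r0; have mx := max_gt0r x r0.
have mxy : Num.max y r <= Num.max x r.
  by rewrite ge_max !le_max xy lexx orbT.
rewrite !ger0_norm ?subr_ge0 ?ler_ln ?posrE//.
rewrite /lnmax -ln_div ?posrE//.
rewrite (le_trans (ln_le_sub1 _)) ?divr_gt0//.
rewrite -{1}(divff (lt0r_neq0 my)) -mulrBl.
apply: (@le_trans _ _ ((x - y) / Num.max y r)).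
  rewrite ler_pM2r ?invr_gt0//.
  by have [] := leP x r; have [] := leP y r; lra.
rewrite ler_wpM2l ?subr_ge0// lef_pV2 ?posrE//.
by rewrite le_max lexx orbT.
Qed.

(** The integrand [log|z - w| - log|w|] with a separate cut-off at each of its poles, [r] at [w = z]
    and [s] at [w = 0]. *)
Definition log_ratio z r s w : R := lnmax r (modulus (z - w)) - lnmax s (modulus w).

(** The cut-offs remove both poles, and at infinity the two logarithms compensate each other because
    [|z - w|] and [|w|] differ by at most [|z|]. The constant [k] bounds the ratio of the two maxima
    in both directions. *)
Lemma bounded_measurable_log_ratio z r s : 0 < r -> 0 < s ->
  bounded_measurable (log_ratio z r s).
Proof.
move=> r0 s0; split.
  have mm u : measurable_fun setT (fun w => modulus (u - w)).
    apply: measurable_fun_continuous_plane => w.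
    apply: (@continuous_comp _ _ _ (fun w => u - w) (@modulus R)).
      by apply: cvgB; [exact: cvg_cst|exact: cvg_id].
    exact: modulus_continuous.
  have mln k u : measurable_fun setT (fun w => lnmax k (modulus (u - w))).
    rewrite /lnmax; apply: measurableT_comp => //.
    by apply: measurable_maxr => //; exact: measurable_cst.
  apply: measurable_funB; first exact: mln.
  by have := mln s 0; under eq_fun do rewrite sub0r modulusN.
pose K := modulus z + r + s; pose k := K / r + K / s + 1.
have mz := modulus_ge0 z.
have K0 : 0 <= K by rewrite /K !addr_ge0// ltW.
have Kr0 : 0 <= K / r by rewrite divr_ge0// ltW.
have Ks0 : 0 <= K / s by rewrite divr_ge0// ltW.
exists (ln k) => w; have mw := modulus_ge0 w.
have kmax e (x : R) : 0 < e -> K / e <= K / r + K / s -> K + x <= k * Num.max x e.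
  move=> e0 Ke; have me := max_gt0r x e0.
  have xm : x <= Num.max x e by rewrite le_max lexx.
  have em : e <= Num.max x e by rewrite le_max lexx orbT.
  rewrite /k mulrDl mul1r lerD// (le_trans _ (ler_wpM2r (ltW me) Ke))//.
  by rewrite -{1}(divfK (lt0r_neq0 e0) K) ler_wpM2l// divr_ge0// ltW.
have mzw : modulus (z - w) <= modulus z + modulus w.
  by rewrite (le_trans (ler_modulusD _ _))// modulusN.
have mwz : modulus w <= modulus z + modulus (z - w).
  by rewrite (le_trans (ler_modulusB w z))// modulusBC.
apply: ln_dist_le; rewrite ?max_gt0r//.
  rewrite (le_trans _ (kmax s (modulus w) s0 _)) ?lerDr// ge_max /K.
  by apply/andP; split; lra.
rewrite (le_trans _ (kmax r (modulus (z - w)) r0 _)) ?lerDl// ge_max /K.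
by apply/andP; split; lra.
Qed.

Lemma ler_log_ratio z v r s w : 0 < r ->
  log_ratio z r s w <= log_ratio v r s w + modulus (z - v) / r.
Proof.
move=> r0; rewrite /log_ratio addrAC lerB// -lerBlDl.
rewrite (le_trans (ler_norm _))// (le_trans (lnmax_lipschitz _ _ r0))//.
rewrite ler_pM2r ?invr_gt0// (le_trans (modulus_lipschitz _ _))//.
by rewrite opprB addrA subrK.
Qed.

End log_max.

Lemma ler_expB_gap (R : realType) (a b k : R) (m : nat) : (0 < m)%N ->
  0 <= a -> 0 < k < 1 -> a <= (1 - k) * b -> k * b ^+ m <= b ^+ m - a ^+ m.
Proof.
move=> m0 a0 /andP[k0 k1] ab.
have k10 : 0 < 1 - k by rewrite subr_gt0.
have b0 : 0 <= b by rewrite -(pmulr_rge0 _ k10) (le_trans a0).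
have am : a ^+ m <= (1 - k) * b ^+ m.
  apply: (@le_trans _ _ (((1 - k) * b) ^+ m)).
    by rewrite lerXn2r ?nnegrE ?mulr_ge0// ltW.
  rewrite exprMn ler_wpM2r ?exprn_ge0//.
  case: m m0 => // m _; rewrite exprS ler_piMr ?(ltW k10)//.
  by rewrite exprn_ile1 ?(ltW k10)// gerBl ltW.
have : b ^+ m = k * b ^+ m + (1 - k) * b ^+ m by ring.
lra.
Qed.

Section unity_rotations.
Variables (R : realType) (m : nat) (rs : seq R[i]).
Hypothesis m_gt0 : (0 < m)%N.
Hypothesis rs_size : size rs = m.
Hypothesis rs_unity : forall x, x \in rs -> x ^+ m = 1.
Hypothesis rs_prod : forall a b : R[i], \prod_(x <- rs) (a - x * b) = a ^+ m - b ^+ m.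
Implicit Types (u v w z : R * R).

Definition rotationC (x : R[i]) : R * R -> R * R :=
  rotation (complex.Re x) (complex.Im x).

Lemma to_C_rotation x w : to_C (rotationC x w) = x * to_C w.
Proof. by case: x => a b; case: w => c e; apply/eqP; rewrite eq_complex/= eqxx/= addrC. Qed.

Lemma unity_modulus x : x \in rs -> (complex.Re x) ^+ 2 + (complex.Im x) ^+ 2 = 1.
Proof.
move=> /rs_unity xm; apply: (@complexI R); rewrite add_Re2_Im2.
have /eqP : `|x| ^+ m = 1 by rewrite -normrX xm normr1.
by rewrite pexpr_eq1// => /eqP ->; rewrite expr1n.
Qed.

Lemma modulus_rotationC x w : x \in rs -> modulus (rotationC x w) = modulus w.
Proof.
move=> /unity_modulus x1; rewrite /modulus/=; congr Num.sqrt.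
rewrite -[RHS]mul1r -x1; ring.
Qed.

Lemma prod_modulus_unity z w :
  `|modulus z ^+ m - modulus w ^+ m| <= \prod_(x <- rs) modulus (z - rotationC x w).
Proof.
rewrite -lecR rmorph_prod/=.
under eq_bigr do rewrite -normC_to_C to_CB to_C_rotation.
rewrite -normr_prod rs_prod.
have nE (t : R) : (`|t|)%:C%C = `|t%:C%C|.
  by rewrite normc_def/= expr0n/= addr0 sqrtr_sqr.
rewrite nE rmorphB/= !rmorphXn/= -!normC_to_C -!normrX.
exact: ler_dist_dist.
Qed.

(** Without cut-off the sum is the logarithm of [|z^m - w^m|]. If the smaller modulus is at most
    [(1 - k) * M], the difference of the [m]-th powers keeps the fraction [k] of [M ^+ m], so the
    loss [ln k] does not depend on [m]. *)
Lemma sum_lnmax_unity z w r (k : R) : 0 < r -> 0 < k < 1 ->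
  let M := Num.max (modulus z) (modulus w) in
  0 < M -> Num.min (modulus z) (modulus w) <= (1 - k) * M ->
  ln k + m%:R * ln M <= \sum_(x <- rs) lnmax r (modulus (z - rotationC x w)).
Proof.
move=> r0 k01 M M0 Mk; have /andP[k0 _] := k01.
have gap : k * M ^+ m <= `|modulus z ^+ m - modulus w ^+ m|.
  move: Mk; rewrite /M; have [zw|wz] := leP (modulus z) (modulus w) => Mk.
    rewrite distrC (le_trans (ler_expB_gap m_gt0 (modulus_ge0 z) k01 Mk))//.
    exact: ler_norm.
  rewrite (le_trans (ler_expB_gap m_gt0 (modulus_ge0 w) k01 Mk))//.
  exact: ler_norm.
rewrite mulr_natl -lnXn// -lnM ?posrE ?exprn_gt0//.
have -> : \sum_(x <- rs) lnmax r (modulus (z - rotationC x w)) =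
    ln (\prod_(x <- rs) Num.max (modulus (z - rotationC x w)) r).
  elim: (rs) => [|x s IH]; first by rewrite !big_nil ln1.
  rewrite !big_cons IH lnM ?posrE ?max_gt0r// prodr_gt0// => y _.
  exact: max_gt0r.
rewrite ler_ln ?posrE ?mulr_gt0 ?exprn_gt0//; last first.
  by rewrite prodr_gt0// => y _; exact: max_gt0r.
rewrite (le_trans gap)// (le_trans (prod_modulus_unity z w))//.
apply: ler_prod => x _; rewrite modulus_ge0/=.
by rewrite le_max lexx.
Qed.

(** When [|z|] and [|w|] are too close for [sum_lnmax_unity], the point [z] is first shrunk to
    [v = t z], so that [|v|] falls clearly below [|w|]. By the Lipschitz bound each term changes by
    at most [2 * k * modulus z / r], and [ln M] exceeds [ln |w|] by at most [2 * k]. *)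
Lemma sum_lnmax_unity_ge z w r (k : R) : 0 < r -> 0 < k <= 1 / 2 -> 0 < modulus z ->
  m%:R * lnmax (modulus z) (modulus w) <=
  \sum_(x <- rs) lnmax r (modulus (z - rotationC x w))
    - ln k + m%:R * (2 * k + 2 * k * modulus z / r).
Proof.
move=> r0 /andP[k0 k12] z0; have k01 : 0 < k < 1 by rewrite k0; lra.
have mz : 0 <= 2 * k * modulus z / r by rewrite !mulr_ge0// ?invr_ge0 ltW.
have m0 : 0 <= m%:R :> R by [].
rewrite /lnmax maxC; set M := Num.max _ _.
have M0 : 0 < M by rewrite /M lt_max z0.
have [Mk|Mk] := leP (Num.min (modulus z) (modulus w)) ((1 - k) * M).
  have := sum_lnmax_unity r0 k01 M0 Mk.
  have : 0 <= m%:R * (2 * k + 2 * k * modulus z / r) by rewrite mulr_ge0// addr_ge0//; lra.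
  lra.
(* One factor [1 - k] makes up for [|z|] possibly exceeding [|w|], the other creates the gap. *)
pose t := (1 - k) * (1 - k).
have tE : t = 1 - 2 * k + k * k by rewrite /t; ring.
have k1 : 0 < 1 - k by lra.
have t0 : 0 < t by rewrite /t mulr_gt0.
have t1 : t <= 1 by rewrite tE; nra.
pose v : R * R := (t * z.1, t * z.2).
have scale (a : R) : 0 <= a -> modulus (a * z.1, a * z.2) = a * modulus z.
  move=> a0; rewrite /modulus/= !exprMn -mulrDr sqrtrM ?sqr_ge0//.
  by rewrite sqrtr_sqr ger0_norm.
have vz : modulus v = t * modulus z by rewrite scale// ltW.
have zv : modulus (v - z) = (1 - t) * modulus z.
  rewrite modulusBC -scale ?subr_ge0//; congr modulus.
  by rewrite /v; case: z {z0 mz M M0 Mk v vz scale} => a b; congr (_, _) => /=; ring.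
have {Mk} [zw wz] : (1 - k) * modulus z < modulus w /\ (1 - k) * modulus w < modulus z.
  move: Mk; rewrite /M; have [zw|zw] := leP (modulus z) (modulus w) => Mk; split=> //.
    by apply: (lt_le_trans _ zw); rewrite gtr_pMl//; lra.
  by rewrite (le_lt_trans _ zw)// ler_piMl ?modulus_ge0//; lra.
have w0 : 0 < modulus w by rewrite (lt_trans _ zw)// mulr_gt0.
have vw : modulus v <= (1 - k) * modulus w.
  by rewrite vz /t -mulrA ler_pM2l// ltW.
have vw' : modulus v <= modulus w.
  by rewrite (le_trans vw)// ger_pMl//; lra.
have M' : Num.max (modulus v) (modulus w) = modulus w by rewrite max_r.
have M'0 : 0 < Num.max (modulus v) (modulus w) by rewrite M'.
have M'k : Num.min (modulus v) (modulus w) <= (1 - k) * Num.max (modulus v) (modulus w).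
  by rewrite M' min_l.
have := sum_lnmax_unity r0 k01 M'0 M'k; rewrite M' => le1.
have lnM : ln M <= ln (modulus w) + 2 * k.
  have Mw : M <= modulus w / (1 - k).
    by rewrite /M ge_max !ler_pdivlMr// ![_ * (1 - k)]mulrC (ltW zw) ger_pMl//; lra.
  have : ln M <= ln (modulus w / (1 - k)) by rewrite ler_ln ?posrE ?divr_gt0.
  move=> /le_trans; apply.
  rewrite ln_div ?posrE// lerD2l -lnV ?posrE//.
  rewrite (le_trans (ln_le_sub1 _)) ?invr_gt0//.
  rewrite lerBlDr -[leLHS]mul1r ler_pdivrMr//; nra.
have le2 : \sum_(x <- rs) lnmax r (modulus (v - rotationC x w)) <=
    \sum_(x <- rs) lnmax r (modulus (z - rotationC x w)) + m%:R * (2 * k * modulus z / r).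
  rewrite -rs_size; elim: (rs) => [|x s IH]; first by rewrite !big_nil mul0r addr0.
  rewrite !big_cons/= -natr1 mulrDl mul1r [X in _ <= _ + X]addrC addrACA lerD//.
  rewrite -lerBlDl (le_trans _ (_ : (1 - t) * modulus z / r <= _))//; last first.
    by rewrite ler_pM2r ?invr_gt0// ler_pM2r// tE; nra.
  rewrite -zv; set a := rotationC x w.
  rewrite (le_trans (ler_norm _))// (le_trans (lnmax_lipschitz _ _ r0))//.
  rewrite ler_pM2r ?invr_gt0// (le_trans (modulus_lipschitz _ _))//.
  by rewrite opprB addrA subrK.
have : m%:R * ln M <= m%:R * (ln (modulus w) + 2 * k) by rewrite ler_wpM2l.
rewrite !mulrDr; lra.
Qed.

End unity_rotations.

Section radial_potential.
Context (R : realType) (mu : probability (R * R)%type R).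
Hypothesis mu_rot : forall (c s : R) (A : set (R * R)), c ^+ 2 + s ^+ 2 = 1 ->
  measurable A -> mu (rotation c s @^-1` A) = mu A.

Lemma Rintegral_rotationC (x : R[i]) (h : R * R -> R) :
  (complex.Re x) ^+ 2 + (complex.Im x) ^+ 2 = 1 -> bounded_measurable h ->
  \int[mu]_u h (rotationC x u) = \int[mu]_u h u.
Proof.
move=> x1 [mh bh]; apply: Rintegral_image => //; first exact: measurable_rotation.
by move=> A mA; exact: mu_rot.
Qed.

(* Averaging over the rotations by the m-th roots of unity x turns the product of the
   |z - x w| into |z^m - w^m|, whose m-th root tends to max(|z|, |w|). *)
Lemma Rintegral_log_ratio_ge (z : R * R) (r s : R) : 0 < r -> 0 < s ->
  0 < modulus z ->
  \int[mu]_w log_ratio 0 (modulus z) s w <= \int[mu]_w log_ratio z r s w.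
Proof.
move=> r0 s0 z0; apply/ler_addgt0Pr => e e0.
(* For each of the [m] rotations the error proportional to [k] is at most [e / 2]; then [m] is taken
   so large that [- ln k], which is paid only once, is at most [m * e / 4]. *)
pose k := Num.min (1 / 2) (Num.min (e / 8) (e * r / (8 * modulus z))).
have k0 : 0 < k by rewrite !lt_min !divr_gt0// !mulr_gt0.
have k12 : k <= 1 / 2 by rewrite ge_min lexx.
have ke : k <= e / 8 by rewrite !ge_min lexx orbT.
have kr : k * modulus z / r <= e / 8.
  have : k <= e * r / (8 * modulus z) by rewrite !ge_min lexx !orbT.
  rewrite ler_pdivlMr ?mulr_gt0// ler_pdivrMr// => ?; lra.
pose m := (Num.truncn (- ln k * (4 / e))).+1.
have m0 : 0 < m%:R :> R by [].
have mk : - ln k <= m%:R * (e / 4).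
  have : - ln k * (4 / e) < m%:R by exact: Num.Theory.truncnS_gt.
  by rewrite -ltr_pdivlMr ?divr_gt0// invf_div => /ltW.
have [rs [szrs [rs1 rsE]]] := @prod_sub_unity_roots R[i] m isT.
have unit1 x : x \in rs -> (complex.Re x) ^+ 2 + (complex.Im x) ^+ 2 = 1.
  by move=> xrs; exact: (unity_modulus (m := m) isT rs1).
have bl (y : R * R) (p : R) : 0 < p -> bounded_measurable (log_ratio y p s).
  by move=> p0; exact: bounded_measurable_log_ratio.
have bx (x : R[i]) : bounded_measurable (fun w => log_ratio z r s (rotationC x w)).
  apply: bounded_measurable_comp; last exact: bl.
  exact: measurable_rotation.
have sumE : \int[mu]_w (\sum_(x <- rs) log_ratio z r s (rotationC x w)) =
    m%:R * \int[mu]_w log_ratio z r s w.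
  rewrite Rintegral_sum// big_seq.
  rewrite (eq_bigr (fun=> \int[mu]_w log_ratio z r s w)) => [|x xrs]; last first.
    by apply: Rintegral_rotationC; [exact: unit1|exact: bl].
  by rewrite -big_seq big_const_seq count_predT szrs iter_addr_0 mulr_natl.
rewrite -(ler_pM2l m0) mulrDr -sumE.
have bs : bounded_measurable (fun w => \sum_(x <- rs) log_ratio z r s (rotationC x w)).
  exact: bounded_measurable_sum.
have bz := bl 0 _ z0.
rewrite -RintegralZl//; last exact: bounded_measurable_integrable.
rewrite -(Rintegral_probability_cst mu (m%:R * e)) -RintegralD//; first last.
- by apply: bounded_measurable_integrable; exact: bounded_measurable_cst.
- exact: bounded_measurable_integrable.
apply: le_bounded_Rintegral => [||w].
- by apply: bounded_measurableM => //; exact: bounded_measurable_cst.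
- by apply: bounded_measurableD => //; exact: bounded_measurable_cst.
have k012 : 0 < k <= 1 / 2 by rewrite k0.
have := sum_lnmax_unity_ge (m := m) isT szrs rsE w r0 k012 z0.
have -> : \sum_(x <- rs) log_ratio z r s (rotationC x w) =
    \sum_(x <- rs) lnmax r (modulus (z - rotationC x w)) - m%:R * lnmax s (modulus w).
  rewrite /log_ratio sumrB; congr (_ - _); rewrite big_seq.
  rewrite (eq_bigr (fun=> lnmax s (modulus w))) => [|x xrs].
    by rewrite -big_seq big_const_seq count_predT szrs iter_addr_0 mulr_natl.
  by rewrite (modulus_rotationC (m := m) isT rs1).
rewrite /log_ratio sub0r modulusN.
have : m%:R * (2 * k + 2 * k * modulus z / r) <= m%:R * (e / 2).
  by rewrite ler_pM2l//; lra.
have : m%:R * (e / 4) + m%:R * (e / 2) <= m%:R * e.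
  by rewrite -mulrDr ler_pM2l//; lra.
rewrite mulrBr; lra.
Qed.

(** The integrand is [log (max(|w|, r1) / max(|w|, s))]: nowhere negative, and equal to
    [ln r1 - ln s] on the disc of radius [s], which has positive mass. *)
Lemma Rintegral_log_ratio0_gt0 (s r1 : R) : 0 < s -> s < r1 ->
  (0 < mu [set w : R * R | (modulus w < s)%R])%E -> 0 < \int[mu]_w log_ratio 0 r1 s w.
Proof.
move=> s0 sr1 mu0; have r10 : 0 < r1 by exact: lt_trans sr1.
pose A := [set w : R * R | modulus w < s].
have mA : measurable A.
  apply: measurable_lt_fun => //.
  by apply: measurable_fun_continuous_plane; exact: modulus_continuous.
have d0 : 0 < ln r1 - ln s by rewrite subr_gt0 ltr_ln ?posrE.
have muA : 0 < fine (mu A) by rewrite fine_gt0// mu0/= (le_lt_trans (probability_le1 mu mA)) ?ltry.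
have bA : bounded_measurable (\1_A : R * R -> R).
  split; first exact: measurable_indic.
  by exists 1 => w; rewrite indicE normr_nat; case: (w \in A); rewrite ?ler01 ?lexx.
have EA : \int[mu]_w (\1_A w) = fine (mu A).
  by rewrite /Rintegral integral_indic// setIT.
apply: (@lt_le_trans _ _ (\int[mu]_w ((ln r1 - ln s) * \1_A w))).
  rewrite RintegralZl//; last exact: bounded_measurable_integrable.
  by rewrite EA mulr_gt0.
apply: le_bounded_Rintegral => [||w].
- by apply: bounded_measurableM => //; exact: bounded_measurable_cst.
- exact: bounded_measurable_log_ratio.
rewrite /log_ratio sub0r modulusN indicE.
have [wA|wA] := boolP (w \in A); last first.
  rewrite mulr0 subr_ge0 /lnmax ler_ln ?posrE ?max_gt0r// ge_max !le_max lexx/=.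
  by rewrite (ltW sr1) orbT.
move/set_mem: wA => /= ws; rewrite mulr1 /lnmax !max_r ?(ltW ws)//.
by rewrite ltW// (lt_trans ws).
Qed.

Lemma Rintegral_log_ratio0_le (s r1 r2 : R) : 0 < s -> 0 < r1 -> r1 <= r2 ->
  \int[mu]_w log_ratio 0 r1 s w <= \int[mu]_w log_ratio 0 r2 s w.
Proof.
move=> s0 r10 r12; have r20 := lt_le_trans r10 r12.
apply: le_bounded_Rintegral => [||w]; [exact: bounded_measurable_log_ratio..|].
rewrite /log_ratio lerB// /lnmax ler_ln ?posrE ?max_gt0r//.
by rewrite ge_max !le_max lexx/= r12 orbT.
Qed.

End radial_potential.

(** * Lines avoided by the level set *)

Section strip_series.
Context (R : realType) (mu : probability (R * R)%type R).
Variables (p : R * R -> R) (a rho K : R).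
Hypothesis p_measurable : measurable_fun setT p.
Hypothesis p_lipschitz : forall u v, `|p u - p v| <= modulus (u - v).
Hypothesis rho_gt0 : 0 < rho.
Hypothesis K_ge0 : 0 <= K.
Hypothesis strip_le : forall delta : R, 0 < delta ->
  (mu [set u : R * R | (`|p u - a| < delta)%R] <= (K * delta)%:E)%E.

Definition strip (j : nat) : set (R * R) :=
  [set u | `|p u - a| < rho / (2 ^ j.+1)%:R].

(** The strips around the line [p = a] are nested with halving widths, so their count at [u] is
    roughly [log2 (rho / |p u - a|)] once this is positive: a nonnegative substitute for the
    logarithmic pole. Its mean is at most the geometric series of the [K * rho / 2^(j+1)], which is
    [K * rho]. *)
Definition strip_count (u : R * R) : \bar R :=
  (\sum_(0 <= j <oo) (\1_(strip j) u)%:E)%E.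

Lemma measurable_strip j : measurable (strip j).
Proof.
apply: measurable_lt_fun => //; apply: measurableT_comp => //.
by apply: measurable_funB => //; exact: measurable_cst.
Qed.

Lemma strip_count_ge0 u : (0 <= strip_count u)%E.
Proof. by apply: nneseries_ge0 => j _ _; rewrite lee_fin. Qed.

Lemma measurable_strip_count : measurable_fun setT strip_count.
Proof.
have m1 j : measurable_fun setT (fun u => (\1_(strip j) u : R)%:E).
  by apply/measurable_EFinP; exact: (measurable_indic (measurable_strip j)).
have p0 j u : setT u -> xpredT j -> (0 <= (\1_(strip j) u : R)%:E)%E.
  by rewrite lee_fin.
exact: (@ge0_emeasurable_sum _ _ _ _ _ xpredT p0 (fun j _ => m1 j)).
Qed.

Lemma integral_strip_count : (\int[mu]_u strip_count u <= (K * rho)%:E)%E.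
Proof.
have m1 j : measurable_fun setT (fun u => (\1_(strip j) u : R)%:E).
  by apply/measurable_EFinP; exact: (measurable_indic (measurable_strip j)).
have p0 j u : setT u -> (0 <= (\1_(strip j) u : R)%:E)%E by rewrite lee_fin.
rewrite (integral_nneseries mu measurableT m1 p0).
apply: (@le_trans _ _ (\sum_(0 <= j <oo) (K%:E * (rho / (2 ^ (j + 1))%:R)%:E))%E).
  apply: lee_nneseries => [j _ _|j _].
    by apply: integral_ge0 => u _; rewrite lee_fin.
  rewrite integral_indic//; last exact: measurable_strip.
  by rewrite setIT -EFinM addn1; apply: strip_le; rewrite divr_gt0// ltr0n expn_gt0.
rewrite nneseriesZl => [|j _]; last by rewrite lee_fin divr_ge0// ltW.
rewrite EFinM lee_wpmul2l ?lee_fin//.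
have := @cvg_geometric_eseries_half R rho 0; rewrite expr0 divr1 => /cvg_lim H.
by rewrite -(H _)//; exact: order_hausdorff.
Qed.

(** [N] is the least index of a strip that misses [u]: the [N] strips before it contain [u]. If
    there were no such index, the count would be infinite. *)
Lemma strip_count_dist u : (strip_count u < +oo)%E ->
  exists N : nat, [/\ (N%:R%:E <= strip_count u)%E, 0 < `|p u - a| &
    rho / 2 <= 2 ^+ N * `|p u - a|].
Proof.
move=> fin_u.
have count_ge N : (forall j, (j < N)%N -> strip j u) -> (N%:R%:E <= strip_count u)%E.
  move=> uN; apply: le_trans (nneseries_lim_ge N _) => [|j _ _]; last by rewrite lee_fin.
  rewrite big_nat (eq_bigr (fun=> 1%:E)) => [|j /andP[_ jN]]; last first.
    by rewrite indicE mem_set//; exact: uN.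
  by rewrite -big_nat sumEFin big_const_nat subn0 iter_addr_0.
have [N0 N0E] : exists N, rho / (2 ^ N.+1)%:R <= `|p u - a|.
  apply: contrapT => noN.
  have all_strips N : (N%:R%:E <= strip_count u)%E.
    by apply: count_ge => j _; rewrite /strip/= ltNge; apply/negP => jN; apply: noN; exists j.
  have := strip_count_ge0 u; move: fin_u all_strips.
  case: (strip_count u) => // x _ /(_ (Num.truncn x).+1) + _.
  by rewrite lee_fin leNgt Num.Theory.truncnS_gt.
have [N NE Nmin] := ex_minnP (ex_intro (fun N => rho / (2 ^ N.+1)%:R <= `|p u - a|) N0 N0E).
exists N; split.
- apply: count_ge => j jN; rewrite /strip/= ltNge; apply/negP => /Nmin.
  by rewrite leqNgt jN.
- by apply: lt_le_trans NE; rewrite divr_gt0// ltr0n expn_gt0.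
- rewrite [leRHS]mulrC -ler_pdivrMr ?exprn_gt0//.
  by move: NE; rewrite expnS natrM natrX invfM mulrA.
Qed.

(** The cut-off at [rho / 2] raises the logarithm by at most [N * ln 2]. The point is that [N] is
    chosen before [z], since [|z - u| >= |p u - a|] for all [z] on the line. *)
Lemma strip_count_lnmax u : (strip_count u < +oo)%E ->
  exists N : nat, (N%:R%:E <= strip_count u)%E /\ forall z, p z = a ->
    0 < modulus (z - u) /\
    lnmax (rho / 2) (modulus (z - u)) <= N%:R * ln 2 + ln (modulus (z - u)).
Proof.
move=> /strip_count_dist[N [Nu d0 rN]]; exists N; split=> // z za.
have dz : `|p u - a| <= modulus (z - u) by rewrite -za distrC.
have z0 := lt_le_trans d0 dz; split=> //.
rewrite mulr_natl -lnXn// -lnM ?posrE ?exprn_gt0//.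
rewrite /lnmax ler_ln ?posrE ?mulr_gt0 ?exprn_gt0 ?max_gt0r ?divr_gt0//.
rewrite ge_max; apply/andP; split.
  by rewrite ler_peMl ?(ltW z0)// exprn_ege1// ler1n.
by rewrite (le_trans rN)// ler_pM2l ?exprn_gt0.
Qed.

End strip_series.

Lemma real_net (R : realType) (B h : R) : 0 < h ->
  exists s : seq R, forall x, `|x| <= B -> exists2 y, y \in s & `|x - y| <= h.
Proof.
move=> h0; pose N := (Num.truncn ((B + B) / h)).+1.
exists [seq - B + i%:R * h | i <- iota 0 N] => x; rewrite ler_norml => /andP[x1 x2].
have xB : 0 <= (x + B) / h by rewrite divr_ge0 ?(ltW h0)//; lra.
have /andP[t1 t2] := Num.Theory.truncn_itv xB.
exists (- B + (Num.truncn ((x + B) / h))%:R * h).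
  apply/mapP; exists (Num.truncn ((x + B) / h)) => //.
  rewrite mem_iota/= add0n /N ltnS; apply: Num.Theory.le_truncn.
  by rewrite ler_pM2r ?invr_gt0//; lra.
move: t1 t2; set q := Num.truncn _.
rewrite ler_pdivlMr// ltr_pdivrMr// -natr1 mulrDl mul1r => t1 t2.
by rewrite ler_norml; apply/andP; split; lra.
Qed.

Lemma plane_net (R : realType) (B h : R) : 0 < h ->
  exists s : seq (R * R), forall u, modulus u <= B ->
    exists2 v, v \in s & modulus (u - v) <= h.
Proof.
move=> h0; have h20 : 0 < h / 2 by rewrite divr_gt0.
have [s sP] := real_net B h20.
exists [seq (x, y) | x <- s, y <- s] => u uB.
have [x xs ux] := sP u.1 (le_trans (ler_fst_modulus u) uB).
have [y ys uy] := sP u.2 (le_trans (ler_snd_modulus u) uB).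
exists (x, y); first exact: allpairs_f.
by rewrite (le_trans (ler_modulus_norms _))//= (splitr h) lerD.
Qed.

Section good_lines.
Context d (T : measurableType d) (R : realType) (P : probability T R).
Context (mu : probability (R * R)%type R) (z : nat -> {RV P >-> (R * R)%type}).
Hypothesis z_distribution : forall k A, measurable A -> distribution P (z k) A = mu A.
Hypothesis z_independent : mutually_independent P z.
Hypothesis mu_rot : forall (c s : R) (A : set (R * R)), c ^+ 2 + s ^+ 2 = 1 ->
  measurable A -> mu (rotation c s @^-1` A) = mu A.
Variables (s r1 : R).
Hypothesis s_gt0 : 0 < s.
Hypothesis s_lt_r1 : s < r1.
Hypothesis mu_disc_gt0 : (0 < mu [set w : R * R | (modulus w < s)%R])%E.

(** [kappa] is spent in thirds: the law of large numbers at the points of a finite net, and the move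
    from [u] to a net point within [kappa * r / 3], once in the integral and once in the empirical
    mean. *)
Lemma log_ratio_uniform_lower_bound (r B kappa : R) : 0 < r -> 0 < kappa ->
  with_high_probability P (fun n t => forall u, modulus u <= B ->
    \int[mu]_w log_ratio u r s w - kappa <=
      n%:R^-1 * \sum_(0 <= k < n) log_ratio u r s (z k t)).
Proof.
move=> r0 k0; pose h := kappa * r / 3.
have h0 : 0 < h by rewrite /h !mulr_gt0.
have hr : h / r = kappa / 3 by rewrite /h; field; rewrite gt_eqF.
have k30 : 0 < kappa / 3 by rewrite divr_gt0.
have [net netP] := plane_net B h0.
have bl u : bounded_measurable (log_ratio u r s) by exact: bounded_measurable_log_ratio.
have := @whp_all _ _ _ P _ net (fun v n t =>
  `|n%:R^-1 * \sum_(0 <= k < n) log_ratio v r s (z k t) -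
    \int[mu]_w log_ratio v r s w| <= kappa / 3).
move=> /(_ (fun v _ => sample_law_of_large_numbers z_distribution z_independent (bl v) k30)).
apply: whp_impl => n t n0 netLLN u /netP[v vnet uv].
have := netLLN v vnet; rewrite ler_norml => /andP[lo _].
have close w : log_ratio v r s w - kappa / 3 <= log_ratio u r s w.
  rewrite lerBlDr (le_trans (ler_log_ratio v u s w r0))// lerD2l -hr.
  by rewrite ler_pM2r ?invr_gt0// modulusBC.
have closeI : \int[mu]_w log_ratio u r s w <= \int[mu]_w log_ratio v r s w + kappa / 3.
  rewrite -(Rintegral_probability_cst mu (kappa / 3)) -RintegralD//; first last.
  - by apply: bounded_measurable_integrable; exact: bounded_measurable_cst.
  - exact: bounded_measurable_integrable.
  apply: le_bounded_Rintegral => // [|w].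
    by apply: bounded_measurableD => //; exact: bounded_measurable_cst.
  rewrite (le_trans (ler_log_ratio u v s w r0))// lerD2l -hr.
  by rewrite ler_pM2r ?invr_gt0.
have closeS : n%:R^-1 * \sum_(0 <= k < n) log_ratio v r s (z k t) - kappa / 3 <=
    n%:R^-1 * \sum_(0 <= k < n) log_ratio u r s (z k t).
  have nn0 : 0 < n%:R :> R by rewrite ltr0n.
  rewrite lerBlDr -(ler_pM2l nn0) mulrDr !mulVKf ?gt_eqF//.
  have -> : n%:R * (kappa / 3) = \sum_(0 <= k < n) (kappa / 3).
    by rewrite big_const_nat subn0 iter_addr_0 mulr_natl.
  rewrite -big_split/=; apply: ler_sum => k _.
  by rewrite -lerBlDr close.
lra.
Qed.

Variable p : R * R -> R.
Hypothesis p_measurable : measurable_fun setT p.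
Hypothesis p_lipschitz : forall u v, `|p u - p v| <= modulus (u - v).
Variable K : R.
Hypothesis K_ge0 : 0 <= K.
Hypothesis strip_le : forall a delta : R, 0 < delta ->
  (mu [set u : R * R | (`|p u - a| < delta)%R] <= (K * delta)%:E)%E.

(* Only the factors |u - z_k| with z_k close to the line are not controlled by the
   law of large numbers; by Markov's inequality their logarithms contribute little,
   uniformly in u on the line since |u - z_k| >= |p z_k - a|. *)
Lemma level_set_avoids_line (a B : R) :
  with_high_probability P (fun n t => forall u, p u = a -> r1 <= modulus u ->
    modulus u <= B ->
    \prod_(k < n) modulus (z k t) < \prod_(k < n) modulus (u - z k t)).
Proof.
move=> delta delta0; have r10 := lt_trans s_gt0 s_lt_r1.
pose D := \int[mu]_w log_ratio 0 r1 s w.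
have D0 : 0 < D by exact: Rintegral_log_ratio0_gt0.
have ln20 : 0 < ln 2 :> R by rewrite ln_gt0// ltr1n.
(* [c] makes [n * c * ln 2] equal to [n * D / 4], the loss allowed to the strip counts; [rho] then
   makes Markov's bound [K * rho / c] at most [delta / 2]. The other half of [delta] goes to the
   uniform law of large numbers. *)
pose c := D / (4 * ln 2).
have c0 : 0 < c by rewrite divr_gt0// mulr_gt0.
pose rho := c * (delta / 2) / (K + 1).
have K10 : 0 < K + 1 by rewrite ltr_wpDl.
have rho0 : 0 < rho by rewrite divr_gt0// mulr_gt0// divr_gt0.
have Krho : K * rho <= c * (delta / 2).
  have X0 : 0 <= c * (delta / 2) by apply: ltW; rewrite mulr_gt0// divr_gt0.
  by rewrite /rho mulrCA ler_piMr// ler_pdivrMr// mul1r lerDl.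
have rho20 : 0 < rho / 2 by rewrite divr_gt0.
have D20 : 0 < D / 2 by rewrite divr_gt0.
have delta20 : 0 < delta / 2 by rewrite divr_gt0.
have [N NP] := log_ratio_uniform_lower_bound B rho20 D20 delta20.
exists (maxn N 1) => n; rewrite geq_max => /andP[/NP[Bad1 [mBad1 PBad1 Bad1P]] n0].
have nn0 : 0 < n%:R :> R by rewrite ltr0n.
pose S (t : T) : \bar R := (\sum_(0 <= k < n) strip_count p a rho (z k t))%E.
have mcount := measurable_strip_count a rho p_measurable.
have mS1 k : measurable_fun setT (fun t => strip_count p a rho (z k t)).
  by apply: measurableT_comp => //; exact: measurable_funPT.
have S0 t : (0 <= S t)%E by apply: sume_ge0 => k _; exact: strip_count_ge0.
have mS : measurable_fun setT S by apply: emeasurable_sum => k; exact: mS1.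
have ES : (\int[P]_t S t <= (n%:R * (K * rho))%:E)%E.
  rewrite /S ge0_integral_sum//; last by move=> k t _; exact: strip_count_ge0.
  apply: (@le_trans _ _ (\sum_(0 <= k < n) (K * rho)%:E)%E).
    apply: lee_sum => k _.
    have := @ge0_integral_distribution _ _ _ _ _ P (z k) _ mcount (strip_count_ge0 p a rho).
    rewrite /= => <-.
    rewrite (@eq_measure_integral _ _ _ _ mu); last by move=> A mA _; exact: z_distribution.
    by apply: integral_strip_count => // e e0; exact: strip_le.
  by rewrite sumEFin big_const_nat subn0 iter_addr_0 mulr_natl.
have nc0 : 0 < n%:R * c by rewrite mulr_gt0.
pose Bad2 := [set t | ((n%:R * c)%:E <= S t)%E].
exists (Bad1 `|` Bad2).
have mBad2 : measurable Bad2.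
  rewrite -[X in measurable X]setTI; exact: emeasurable_fun_c_infty.
split; first exact: measurableU.
  apply: le_trans (measureU2 _ mBad1 mBad2) _.
  rewrite (splitr delta) EFinD leeD//.
  have := le_trans (markov_ge0 P mS S0 nc0) ES.
  rewrite -lee_pdivlMl// -EFinM => /le_trans; apply.
  rewrite lee_fin ler_pdivrMl// -mulrA ler_pM2l//.
move=> t /not_orP[nBad1 nBad2] u ua ru uB.
have {nBad2} Slt : (S t < (n%:R * c)%:E)%E by rewrite ltNge; exact/negP.
have fink k : (k < n)%N -> (strip_count p a rho (z k t) < +oo)%E.
  move=> kn; apply: (@le_lt_trans _ _ (S t)); last by rewrite (lt_trans Slt)// ltry.
  rewrite /S (bigD1_seq k) ?mem_index_iota ?iota_uniq//= leeDl// sume_ge0// => j _.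
  exact: strip_count_ge0.
have /choice[M MP] : forall k, exists M : nat, (k < n)%N ->
    (M%:R%:E <= strip_count p a rho (z k t))%E /\ 0 < modulus (u - z k t) /\
    lnmax (rho / 2) (modulus (u - z k t)) <= M%:R * ln 2 + ln (modulus (u - z k t)).
  move=> k; have [kn|_] := ltnP k n; last by exists 0%N.
  have [M [M1 M2]] := strip_count_lnmax p_lipschitz rho0 (fink k kn).
  by exists M => _; split => //; exact: M2.
have Msum : \sum_(0 <= k < n) (M k)%:R < n%:R * c.
  rewrite -lte_fin -sumEFin; apply: le_lt_trans Slt.
  rewrite /S !big_nat; apply: lee_sum => k /andP[_ kn].
  by have [] := MP k kn.
have := Bad1P t nBad1 u uB.
have : D <= \int[mu]_w log_ratio u (rho / 2) s w.
  apply: le_trans (Rintegral_log_ratio_ge mu_rot rho20 s_gt0 (lt_le_trans r10 ru)).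
  exact: Rintegral_log_ratio0_le.
move=> DI; rewrite lerBlDr => /(le_trans DI).
rewrite -lerBlDr -(ler_pM2l nn0) mulVKf ?gt_eqF//.
rewrite /log_ratio sumrB => main.
have ub_sum : \sum_(0 <= k < n) lnmax (rho / 2) (modulus (u - z k t)) <=
    (\sum_(0 <= k < n) (M k)%:R) * ln 2 + \sum_(0 <= k < n) ln (modulus (u - z k t)).
  rewrite mulr_suml -big_split/= !big_nat; apply: ler_sum => k /andP[_ kn].
  by have [_ []] := MP k kn.
have cln2 : n%:R * c * ln 2 = n%:R * (D / 4).
  by rewrite /c -mulrA; congr (_ * _); field; rewrite gt_eqF.
have Mln2 : (\sum_(0 <= k < n) (M k)%:R) * ln 2 < n%:R * (D / 4).
  by rewrite -cln2 ltr_pM2r.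
have nD : 0 < n%:R * D by rewrite mulr_gt0.
(* Of the integral, at least [D], the law of large numbers takes [D / 2] and the cut-off at
   [rho / 2] less than [D / 4], so a positive amount remains. *)
have lt_ln : \sum_(0 <= k < n) lnmax s (modulus (z k t)) <
    \sum_(0 <= k < n) ln (modulus (u - z k t)).
  rewrite mulrBr in main; lra.
have lnprod (F : nat -> R) : (forall k, (k < n)%N -> 0 < F k) ->
    ln (\prod_(k < n) F k) = \sum_(0 <= k < n) ln (F k).
  elim: (n) => [|m IH] F0; first by rewrite big_ord0 big_geq// ln1.
  have Fm k : (k < m)%N -> 0 < F k by move=> km; apply: F0; exact: ltnW.
  have prod0 : 0 < \prod_(k < m) F k by apply: prodr_gt0 => k _; exact: Fm.
  have F00 : 0 < F m by exact: F0.
  by rewrite big_ord_recr big_nat_recr//= lnM ?posrE// IH.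
(* The product of the [|z_k|] only has to be bounded above, so the cut-off at [s] works in the right
   direction. *)
apply: (@le_lt_trans _ _ (\prod_(k < n) Num.max (modulus (z k t)) s)).
  by apply: ler_prod => k _; rewrite modulus_ge0 le_max lexx.
have u0 k : (k < n)%N -> 0 < modulus (u - z k t) by move=> kn; have [_ []] := MP k kn.
rewrite -ltr_ln ?posrE.
- rewrite (lnprod (fun k => Num.max (modulus (z k t)) s)) => [|k _]; last exact: max_gt0r.
  by rewrite (lnprod (fun k => modulus (u - z k t))).
- by apply: prodr_gt0 => k _; exact: max_gt0r.
- by apply: prodr_gt0 => k _; exact: u0.
Qed.

End good_lines.

(** * Comparison of the two empirical measures *)

Section test_functions.
Context (R : realType) (f : R * R -> R).
Hypothesis f_continuous : continuous f.
Hypothesis f_compact : compact (closure [set u : R * R | f u != 0]).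

Lemma compact_support_bounded : exists2 M : R, 0 <= M & forall u, `|f u| <= M.
Proof.
have [N [_ Nb]] : bounded_set (f @` closure [set u : R * R | f u != 0]).
  apply: compact_bounded; apply: continuous_compact => //.
  exact: continuous_subspaceT.
exists (`|N| + 1) => [|u]; first by rewrite addr_ge0.
have [->|fu] := eqVneq (f u) 0; first by rewrite normr0 addr_ge0.
apply: (Nb (`|N| + 1)); first by rewrite ltr_pwDr// ler_norm.
by exists u => //; exact: subset_closure.
Qed.

(** Compactness of the support gives one [delta] for all its points. In a pair of points where [f]
    does not vanish at both, one lies in the support, and the roles may be exchanged. *)
Lemma compact_support_unif_continuous (e : R) : 0 < e ->
  exists2 delta : R, 0 < delta &
    forall u v, modulus (u - v) < delta -> `|f u - f v| < e.
Proof.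
move=> e0; pose near_f (delta : R) (u : R * R) :=
  forall v, modulus (u - v) < delta -> `|f u - f v| < e.
have /compact_near_coveringP/(_ R (0 : R)^'+ near_f _) H := f_compact.
have /H : forall x, closure [set u : R * R | f u != 0] x ->
    \forall x' \near x & delta \near 0^'+, near_f delta x'.
  move=> x _; have e20 : 0 < e / 2 by rewrite divr_gt0.
  have /cvgrPdist_lt/(_ _ e20)/nbhs_ballP[b/= b0 xb] := @f_continuous x.
  have b20 : 0 < b / 2 by rewrite divr_gt0.
  exists ([set y | modulus (x - y) < b / 2], [set t | t < b / 2]) => /=.
    by split; [exact: near_modulus|exact: nbhs_right_lt].
  move=> [y t] /= [xy tb] v yv.
  have fx u : modulus (x - u) < b -> `|f x - f u| < e / 2.
    move=> xu; apply: xb; rewrite -ball_normE/=.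
    exact: le_lt_trans (ler_norm_modulus _) xu.
  have xv : modulus (x - v) < b.
    rewrite -(subrKA y) (splitr b) (le_lt_trans (ler_modulusD _ _))// ltrD//.
    exact: lt_trans yv tb.
  have xy' : modulus (x - y) < b by rewrite (lt_trans xy)// gtr_pMr// invf_lt1// ltr1n.
  rewrite (splitr e) (le_lt_trans (ler_distD (f x) _ _))// ltrD ?fx//.
  by rewrite distrC fx.
move=> near_K.
have [delta [delta0 Kdelta]] : exists delta : R, 0 < delta /\
    closure [set u : R * R | f u != 0] `<=` near_f delta.
  near (0 : R)^'+ => delta; exists delta; split; first by near: delta; exact: nbhs_right_gt.
  by near: delta.
exists delta => // u v uv.
have [fu|fu] := eqVneq (f u) 0; last by apply: Kdelta => //; exact: subset_closure.
have [fv|fv] := eqVneq (f v) 0; first by rewrite fu fv subrr normr0.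
rewrite distrC; apply: Kdelta; first exact: subset_closure.
by rewrite modulusBC.
Unshelve. all: by end_near.
Qed.

End test_functions.

Lemma Rintegral_empirical_measure (R : realType) (n : nat) (w : nat -> R * R)
    (f : R * R -> R) : measurable_fun setT f ->
  \int[empirical_measure n w]_u f u = n%:R^-1 * \sum_(0 <= k < n) f (w k).
Proof.
move=> mf.
have ge0_case (h : R * R -> R) : measurable_fun setT h -> (forall u, 0 <= h u) ->
    (\int[empirical_measure n w]_u (h u)%:E = (n%:R^-1 * \sum_(0 <= k < n) h (w k))%:E)%E.
  move=> mh h0; have mh' : measurable_fun setT (EFin \o h) by exact/measurable_EFinP.
  rewrite ge0_integral_mscale//; last by move=> u _; rewrite lee_fin.
  rewrite ge0_integral_measure_sum//; last by move=> u _; rewrite lee_fin.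
  rewrite EFinM; congr (_ * _)%E.
  rewrite -sumEFin big_mkord; apply: eq_bigr => k _.
  by rewrite integral_dirac// diracT mul1e.
rewrite /Rintegral integralE.
have posE : (fun u => (f u)%:E)^\+%E = (fun u => (Num.max (f u) 0)%:E).
  by apply/funext => u; rewrite funeposE EFin_max.
have negE : (fun u => (f u)%:E)^\-%E = (fun u => (Num.max (- f u) 0)%:E).
  by apply/funext => u; rewrite funenegE EFin_max.
have mp : measurable_fun setT (fun u => Num.max (f u) 0).
  by apply: measurable_maxr => //; exact: measurable_cst.
have mn : measurable_fun setT (fun u => Num.max (- f u) 0).
  by apply: measurable_maxr; [exact: measurableT_comp|exact: measurable_cst].
have p0 u : 0 <= Num.max (f u) 0 by rewrite le_max lexx orbT.
have n0 u : 0 <= Num.max (- f u) 0 by rewrite le_max lexx orbT.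
rewrite posE negE (ge0_case _ mp p0) (ge0_case _ mn n0)/=.
rewrite -mulrBr -sumrB; congr (_ * _); apply: eq_bigr => k _.
by have [] := leP (f (w k)) 0; have [] := leP (- f (w k)) 0; lra.
Qed.

(** [rs] is the supremum of the radii of null discs; it may be positive, as [mu] may have no mass
    around 0. Circles being null, the closed disc of radius [rs] is null, so by continuity from
    above slightly larger discs have mass at most [e], and by the choice of [rs] this mass is not
    zero. *)
Lemma exists_hole_radii (R : realType) (mu : probability (R * R)%type R) (B e : R) :
  mu [set u : R * R | (B < modulus u)%R] = 0%E ->
  (forall r : R, mu [set u : R * R | modulus u = r] = 0%E) -> 0 < e ->
  exists s r : R, [/\ 0 < s, s < r, (0 < mu [set w : R * R | (modulus w < s)%R])%E &
    (mu [set w : R * R | (modulus w < r)%R] <= e%:E)%E].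
Proof.
move=> muB mu_circle e0.
have mm : measurable_fun setT (@modulus R).
  by apply: measurable_fun_continuous_plane; exact: modulus_continuous.
have mdisc (r : R) : measurable [set w : R * R | modulus w < r].
  exact: measurable_lt_fun.
have mono (a b : R) : a <= b ->
    (mu [set w : R * R | (modulus w < a)%R] <= mu [set w : R * R | (modulus w < b)%R])%E.
  by move=> ab; apply: le_measure; rewrite ?inE// => w /= /lt_le_trans; exact.
pose S := [set r : R | mu [set w : R * R | (modulus w < r)%R] = 0%E].
have S0 : S 0.
  rewrite /S/= (_ : mkset _ = set0) ?measure0//.
  by apply/seteqP; split => w //=; rewrite ltNge modulus_ge0.
have Sub : ubound S (B + 1).
  move=> r Sr; rewrite leNgt; apply/negP => rB.
  have : (mu setT <= mu [set w : R * R | (modulus w < r)%R] +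
      mu [set u : R * R | (B < modulus u)%R])%E.
    have mo : measurable [set u : R * R | B < modulus u] by exact: measurable_lt_fun.
    rewrite (le_trans _ (measureU2 _ (mdisc r) mo))//.
    apply: le_measure; rewrite ?inE//; first exact: measurableU.
    move=> w _ /=; have [] := ltP (modulus w) r; first by left.
    by move=> rw; right; apply: lt_le_trans rw; apply: lt_trans rB; rewrite ltrDl.
  by rewrite probability_setT Sr muB adde0 lee_fin ler10.
have hS : has_sup S by split; [exists 0|exists (B + 1)].
pose rs := sup S.
have rs0 : 0 <= rs by exact: (sup_upper_bound hS).
have below : mu [set w : R * R | (modulus w < rs)%R] = 0%E.
  apply: measure_negligible => //.
  rewrite (_ : mkset _ = \bigcup_n [set w : R * R | modulus w < rs - n.+1%:R^-1]).
    apply: negligible_bigcup => n; apply/negligibleP => //.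
    have n0 : 0 < n.+1%:R^-1 :> R by rewrite invr_gt0.
    have [r Sr rsr] := sup_adherent n0 hS.
    by apply/eqP; rewrite -measure_le0 (le_trans (mono _ _ (ltW rsr)))// Sr.
  apply/seteqP; split => w /=; last first.
    by move=> [n _ /= /lt_le_trans]; apply; rewrite gerBl.
  move=> wrs; have d0 : 0 < rs - modulus w by rewrite subr_gt0.
  have [m _ /(_ m (leqnn m))/= me] := near_infty_natSinv_lt (PosNum d0).
  by exists m => //=; rewrite ltrBrDl -ltrBrDr; exact: me.
have ball_null : mu (\bigcap_n [set w : R * R | modulus w < rs + n.+1%:R^-1]) = 0%E.
  rewrite (_ : bigcap _ _ = [set w : R * R | modulus w < rs] `|` [set w : R * R | modulus w = rs]).
    apply/eqP; rewrite -measure_le0.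
    have mc : measurable [set w : R * R | modulus w = rs] by exact: measurable_eq_fun.
    rewrite (le_trans (measureU2 _ (mdisc rs) mc))//.
    by rewrite [X in (X + _)%E]below [X in (_ + X)%E]mu_circle adde0.
  apply/seteqP; split => w /=.
    move=> H; have [|rw|->] := ltgtP (modulus w) rs; [by left| |by right].
    have d0 : 0 < modulus w - rs by rewrite subr_gt0.
    have [m _ /(_ m (leqnn m))/= me] := near_infty_natSinv_lt (PosNum d0).
    have /= := H m I; rewrite -ltrBlDl => /lt_trans /(_ me).
    by rewrite ltxx.
  have p0 (n : nat) : 0 < n.+1%:R^-1 :> R by rewrite invr_gt0.
  by move=> [/= wrs|/= wrs] n _ /=; rewrite ?wrs ?ltrDl ?p0// (lt_trans wrs)// ltrDl p0.
have cvg0 : mu [set w : R * R | (modulus w < rs + n.+1%:R^-1)%R] @[n --> \oo] --> 0%E.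
  rewrite -ball_null; apply: nonincreasing_cvg_mu => //.
  - by rewrite (le_lt_trans (probability_le1 mu (mdisc _)))// ltry.
  - by apply: bigcapT_measurable.
  - apply/nonincreasing_seqP => n; apply/subsetPset => w /= /lt_le_trans; apply.
    by rewrite lerD2l lef_pV2 ?posrE// ler_nat.
have [n ne] : exists n : nat, (mu [set w : R * R | (modulus w < rs + n.+1%:R^-1)%R] <= e%:E)%E.
  move/fine_cvgP: cvg0 => [_ /cvgrPdist_lt/(_ e e0)[n _ /(_ n (leqnn n))/=]].
  rewrite sub0r normrN ger0_norm ?fine_ge0// => ne; exists n.
  rewrite -(@fineK _ (mu _)) ?lee_fin ?ltW//.
  by rewrite ge0_fin_numE// (le_lt_trans (probability_le1 mu (mdisc _)))// ltry.
have p0 : 0 < n.+1%:R^-1 :> R by rewrite invr_gt0.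
exists (rs + n.+1%:R^-1 / 2), (rs + n.+1%:R^-1); split => //.
- by rewrite ltr_wpDl// divr_gt0.
- by rewrite ltrD2l ltr_pdivrMr// ltr_pMr// ltr1n.
- rewrite lt0e measure_ge0 andbT; apply/negP => /eqP Sn.
  have : rs + n.+1%:R^-1 / 2 <= rs by exact: (sup_upper_bound hS).
  by rewrite leNgt ltrDl divr_gt0.
Qed.

Lemma whp_cvg_in_probability d (T : measurableType d) (R : realType)
    (P : probability T R) (X : nat -> T -> R) (c : R) :
  (forall n, measurable_fun setT (X n)) ->
  (forall e : R, 0 < e -> with_high_probability P (fun n t => `|X n t - c| < e)) ->
  cvg_in_probability P X c.
Proof.
move=> mX whpX; split=> // e e0.
have mE n : measurable [set t | e <= `|X n t - c|].
  rewrite (_ : mkset _ = ~` [set t | `|X n t - c| < e]).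
    apply: measurableC; apply: measurable_lt_fun => //.
    apply: measurableT_comp => //; apply: measurable_funB => //.
  by apply/seteqP; split => t /=; rewrite leNgt => /negP.
apply/fine_cvgP; split.
  by near=> n; rewrite ge0_fin_numE// (le_lt_trans (probability_le1 P (mE n)))// ltry.
apply/cvgrPdist_le => delta delta0; have [N NP] := whpX e e0 _ delta0.
exists N => // n /= /NP[Bad [mBad PBad BadP]].
rewrite sub0r normrN ger0_norm ?fine_ge0//.
rewrite -lee_fin fineK; last first.
  by rewrite ge0_fin_numE// (le_lt_trans (probability_le1 P (mE n)))// ltry.
apply: le_trans PBad; apply: le_measure; rewrite ?inE// => t /= Xe.
by apply: contrapT => /BadP; rewrite ltNge Xe.
Unshelve. all: by end_near.
Qed.

Lemma floor_locally_constant (R : realType) (x h : R) : 0 < h ->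
  (forall i : int, x <> i%:~R * h) ->
  exists2 e, 0 < e & forall y, `|x - y| < e -> Num.floor (y / h) = Num.floor (x / h).
Proof.
move=> h0 xh; set i := Num.floor (x / h).
have /andP[i1 i2] := floor_itv (x / h).
have {}i1 : i%:~R * h < x.
  rewrite lt_neqAle -ler_pdivlMr// i1 andbT; apply/eqP => ix; exact: xh (esym ix).
have {}i2 : x < (i + 1)%:~R * h by rewrite -ltr_pdivrMr.
exists (Num.min (x - i%:~R * h) ((i + 1)%:~R * h - x)).
  by rewrite lt_min !subr_gt0 i1.
move=> y; rewrite lt_min !ltr_norml => /andP[/andP[_ y1] /andP[y2 _]].
apply: floor_def; rewrite ler_pdivlMr// ltr_pdivrMr//.
by apply/andP; split; lra.
Qed.

(** * Counting points and solutions cell by cell *)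

Section grid.
Context (R : realType) (n : nat) (z w : nat -> R * R) (h r1 B : R).
Hypothesis n_gt0 : (0 < n)%N.
Hypothesis h_gt0 : 0 < h.
Hypothesis w_solutions : solutions_of_level n (root_poly n z) w.
Hypothesis z_bounded : forall k, modulus (z k) <= B.
Hypothesis level_set_avoids_grid : forall (u : R * R) (i : int),
  u.1 = i%:~R * h \/ u.2 = i%:~R * h -> r1 <= modulus u -> modulus u <= 2 * B ->
  \prod_(k < n) modulus (z k) < \prod_(k < n) modulus (u - z k).

Definition grid_cell (u : R * R) : int * int := (Num.floor (u.1 / h), Num.floor (u.2 / h)).

(* All the cells that meet the disc of radius r1 are merged into one, coded by None. *)
Definition merged_cell (u : R * R) : option (int * int) :=
  if `[< exists v, grid_cell v = grid_cell u /\ modulus v < r1 >] then None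
  else Some (grid_cell u).

(** Beyond radius [2 * B] every factor satisfies [|u - z_k| > B >= |z_k|]. Hence only a bounded part
    of the grid has to be avoided. *)
Lemma level_set_bounded (u : R * R) :
  \prod_(k < n) modulus (u - z k) <= \prod_(k < n) modulus (z k) ->
  modulus u <= 2 * B.
Proof.
rewrite leNgt => /negP pu; rewrite leNgt; apply/negP => uB; apply: pu.
have lt k : modulus (z k) < modulus (u - z k).
  have := ler_modulusB u (z k); have := z_bounded k; lra.
have gt0 (m : nat) : 0 < \prod_(k < m) modulus (u - z k).
  by apply: prodr_gt0 => k _; exact: le_lt_trans (modulus_ge0 _) (lt k).
case: n n_gt0 => // m _; rewrite !big_ord_recr/=.
apply: (@le_lt_trans _ _ (\prod_(k < m) modulus (u - z k) * modulus (z m))).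
  rewrite ler_wpM2r ?modulus_ge0//; apply: ler_prod => k _.
  by rewrite modulus_ge0 ltW.
by rewrite ltr_pM2l.
Qed.

(** In the open disc of radius [r1] the label is [None] throughout; outside it the level set stays
    off the grid lines, where both floors are locally constant. This is what [perm_map_solutions]
    asks of a labelling. *)
Lemma merged_cell_locally_constant (u : R * R) :
  \prod_(k < n) modulus (u - z k) <= \prod_(k < n) modulus (z k) ->
  exists2 e, 0 < e & forall v, modulus (u - v) < e -> merged_cell v = merged_cell u.
Proof.
move=> pu; have uB := level_set_bounded pu.
have [ur|ru] := ltP (modulus u) r1.
  have None_in v : modulus v < r1 -> merged_cell v = None.
    by move=> vr; rewrite /merged_cell; case: asboolP => // -[]; exists v.
  exists (r1 - modulus u); first by rewrite subr_gt0.
  move=> v uv; rewrite !None_in//.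
  by have := ler_modulusB v u; rewrite (modulusBC v); lra.
have off (i : int) : ~ (u.1 = i%:~R * h \/ u.2 = i%:~R * h).
  by move=> /level_set_avoids_grid/(_ ru uB); rewrite ltNge pu.
have [|e1 e10 he1] := @floor_locally_constant R u.1 h h_gt0.
  by move=> i ui; apply: (off i); left.
have [|e2 e20 he2] := @floor_locally_constant R u.2 h h_gt0.
  by move=> i ui; apply: (off i); right.
exists (Num.min e1 e2) => [|v]; first by rewrite lt_min e10.
rewrite lt_min => /andP[v1 v2].
have -> // : merged_cell v = merged_cell u.
suff cE : grid_cell v = grid_cell u by rewrite /merged_cell cE.
rewrite /grid_cell (he1 v.1 (le_lt_trans (ler_fst_modulus (u - v)) v1)).
by rewrite (he2 v.2 (le_lt_trans (ler_snd_modulus (u - v)) v2)).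
Qed.

Lemma grid_cell_close (u v : R * R) : grid_cell u = grid_cell v -> modulus (u - v) < 2 * h.
Proof.
have close (x y : R) : Num.floor (x / h) = Num.floor (y / h) -> `|x - y| < h.
  move=> xy; have /andP[x1 x2] := floor_itv (x / h).
  have /andP[y1 y2] := floor_itv (y / h).
  move: x1 x2 y1 y2; rewrite xy intrD !ler_pdivlMr// !ltr_pdivrMr// mulrDl mul1r.
  by move=> x1 x2 y1 y2; rewrite ltr_norml; apply/andP; split; lra.
move=> [/close uv1 /close uv2]; apply: le_lt_trans (ler_modulus_norms _) _ => /=.
by rewrite mulr_natl mulr2n ltrD.
Qed.

Variables (f : R * R -> R) (M e : R).
Hypothesis M_ge0 : 0 <= M.
Hypothesis e_ge0 : 0 <= e.
Hypothesis f_bounded : forall u, `|f u| <= M.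
Hypothesis f_close : forall u v, modulus (u - v) < 2 * h -> `|f u - f v| <= e.

Lemma sum_solutions_close :
  `|\sum_(0 <= k < n) f (w k) - \sum_(0 <= k < n) f (z k)| <=
    2 * (n%:R * e + M * \sum_(0 <= k < n) \1_[set u | modulus u < r1 + 2 * h] (z k)).
Proof.
(* [F] samples [f] at the lower left corner of the cell and [H] singles out the merged cell. Both
   depend on the label alone, so their sums over the [w k] and over the [z k] agree; the factor 2
   arises from comparing [f] with [F] on both sides. *)
pose F (c : option (int * int)) : R :=
  if c is Some (i, j) then f (i%:~R * h, j%:~R * h) else 0.
pose H (c : option (int * int)) : R := (c == None)%:R.
have perm := perm_map_solutions n_gt0 w_solutions merged_cell_locally_constant.
have sumE (G : option (int * int) -> R) :
    \sum_(0 <= k < n) G (merged_cell (w k)) = \sum_(0 <= k < n) G (merged_cell (z k)).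
  have E (v : nat -> R * R) : \sum_(0 <= k < n) G (merged_cell (v k)) =
      \sum_(c <- [seq merged_cell (v k) | k <- iota 0 n]) G c.
    by rewrite big_map -iotaE.
  by rewrite !E; exact: perm_big.
have near_cell u : `|f u - F (merged_cell u)| <= e + M * H (merged_cell u).
  rewrite /merged_cell; case: asboolP => _ /=.
    by rewrite subr0 /H eqxx mulr1 (le_trans (f_bounded u))// lerDr.
  rewrite /H/= mulr0 addr0; apply: f_close; apply: grid_cell_close.
  by rewrite /grid_cell/= !mulfK ?gt_eqF// !intrKfloor.
have sum_close (v : nat -> R * R) :
    `|\sum_(0 <= k < n) f (v k) - \sum_(0 <= k < n) F (merged_cell (v k))| <=
    n%:R * e + M * \sum_(0 <= k < n) H (merged_cell (v k)).
  rewrite -sumrB (le_trans (ler_norm_sum _ _ _))//.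
  apply: (@le_trans _ _ (\sum_(0 <= k < n) (e + M * H (merged_cell (v k))))).
    by apply: ler_sum => k _.
  by rewrite big_split/= big_const_nat subn0 iter_addr_0 mulr_natl -mulr_sumr.
(* Two points of a cell are less than [2 * h] apart, so the merged cell lies within radius
   [r1 + 2 * h]. *)
have hole u : H (merged_cell u) <= \1_[set u | modulus u < r1 + 2 * h] u.
  rewrite /H /merged_cell; case: asboolP => [[v [vu vr]]|_]/=; last first.
    by rewrite indicE; case: (_ \in _).
  rewrite indicE mem_set//=.
  by have := grid_cell_close vu; have := ler_modulusB u v; rewrite (modulusBC u); lra.
have holes : M * \sum_(0 <= k < n) H (merged_cell (z k)) <=
    M * \sum_(0 <= k < n) \1_[set u | modulus u < r1 + 2 * h] (z k).
  by rewrite ler_wpM2l//; apply: ler_sum => k _.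
have := sum_close w; have := sum_close z; rewrite (sumE F) (sumE H).
rewrite !ler_norml => /andP[z1 z2] /andP[w1 w2].
by apply/andP; split; lra.
Qed.

End grid.

Lemma int_range (R : realType) (A h : R) : 0 < h ->
  exists s : seq int, forall i : int, `|i%:~R * h| <= A -> i \in s.
Proof.
move=> h0; pose L := (Num.truncn (A / h)).+1.
exists [seq (Posz j - Posz L)%R | j <- iota 0 (L + L).+1] => i iA.
have iL : `|i| <= Posz L.
  rewrite -(ler_int R) intr_norm; apply: (@le_trans _ _ (A / h)).
    by rewrite ler_pdivlMr// -[X in _ * X](gtr0_norm h0) -normrM.
  by apply: ltW; exact: Num.Theory.truncnS_gt.
apply/mapP; exists (absz (i + Posz L)); last first.
  by rewrite gez0_abs ?addrK//; move: iL; rewrite ler_norml => /andP[]; lia.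
rewrite mem_iota/= add0n; move: iL; rewrite ler_norml => /andP[]; lia.
Qed.

Theorem theorem1 (R : realType) (mu : probability (R * R)%type R)
    (g : R * R -> R)
    (mu_compact : compact (msupport mu))
    (g_density : has_density mu g)
    (g_continuous : continuous g)
    (g_radial : radial g)
    (d : measure_display) (T : measurableType d) (P : probability T R)
    (z : nat -> {RV P >-> (R * R)%type})
    (z_distribution : forall (k : nat) (A : set (R * R)), measurable A ->
      distribution P (z k) A = mu A)
    (z_independent : mutually_independent P z)
    (w : nat -> nat -> T -> R * R)
    (w_solutions : forall (n : nat) (omega : T),
      solutions_of_level n (root_poly n (fun k => z k omega))
        (fun k => w n k omega)) :
  cvg_distributions_in_probability P
    (fun n omega => empirical_measure n (fun k => w n k omega)) mu.
Proof.
move=> f [f_smooth f_compact]; have f_cont : continuous f by exact: (f_smooth 0%N).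
have mf : measurable_fun setT f by exact: measurable_fun_continuous_plane.
have XE n t : \int[empirical_measure n (fun k => w n k t)]_u f u =
    n%:R^-1 * \sum_(0 <= k < n) f (w n k t) by exact: Rintegral_empirical_measure.
apply: whp_cvg_in_probability => [n|e e0].
  under eq_fun do rewrite XE; apply: measurable_funM; first exact: measurable_cst.
  apply: (measurable_sum_solutions (z := fun k t => z k t)) => // k.
have [M M0 fM] := compact_support_bounded f_cont f_compact.
have e80 : 0 < e / 8 by rewrite divr_gt0.
have [delta delta0 fdelta] := compact_support_unif_continuous f_cont f_compact e80.
have [B B0 muB] := mu_outside_ball mu_compact g_density g_continuous.
have [K K0 Kstrip] := mu_strips mu_compact g_density g_continuous.
have mu_rot := mu_rotation g_density g_continuous g_radial.
(* The mass of the disc and the deviation of its empirical mass are each at most this, so that the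
   merged cell contributes at most [M * e / (8 * (M + 1)) <= e / 8]. Altogether the error is at most
   [2 * (e / 8 + e / 8) + e / 8 < e]. *)
have e10 : 0 < e / (16 * (M + 1)) by rewrite divr_gt0// mulr_gt0// ltr_wpDl.
have [s [r [s0 sr mus mur]]] := exists_hole_radii muB
  (mu_circle mu_compact g_density g_continuous) e10.
pose r1 := (s + r) / 2.
have sr1 : s < r1 by rewrite /r1; lra.
have r1r : r1 < r by rewrite /r1; lra.
(* Then [f] varies by at most [e / 8] within a cell, and the merged cell stays inside the disc of
   radius [r]. *)
pose h := Num.min delta (r - r1) / 2.
have h0 : 0 < h by rewrite divr_gt0// lt_min delta0 subr_gt0.
have h2 : 2 * h = Num.min delta (r - r1) by rewrite /h mulrC divfK.
(* Only finitely many grid lines come within [2 * B] of the origin, which permits a union bound over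
   the lines. *)
have [Is IsP] := int_range (2 * B) h0.
have f_close u v : modulus (u - v) < 2 * h -> `|f u - f v| <= e / 8.
  by move=> uv; apply/ltW/fdelta/(lt_le_trans uv); rewrite h2 ge_min lexx.
have bf : bounded_measurable f by split=> //; exists M.
have mD : measurable [set u : R * R | modulus u < r].
  apply: measurable_lt_fun => //.
  by apply: measurable_fun_continuous_plane; exact: modulus_continuous.
have bD : bounded_measurable (\1_[set u : R * R | modulus u < r] : R * R -> R).
  split; first exact: measurable_indic.
  by exists 1 => u; rewrite indicE normr_nat; case: (u \in _); rewrite ?ler01 ?lexx.
have ED : \int[mu]_u \1_[set u : R * R | modulus u < r] u <= e / (16 * (M + 1)).
  rewrite /Rintegral integral_indic// setIT -lee_fin fineK//.
  by rewrite ge0_fin_numE// (le_lt_trans (probability_le1 mu mD))// ltry.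
have whp_box : with_high_probability P (fun n t => forall k, ~ (B < modulus (z k t))).
  apply: (@whp_ae _ _ _ P (fun k => [set t | B < modulus (z k t)])) => k.
    apply: measurable_lt_fun => //; apply: measurableT_comp => //.
    by apply: measurable_fun_continuous_plane; exact: modulus_continuous.
  rewrite -muB -(z_distribution k)//.
  apply: measurable_lt_fun => //.
  by apply: measurable_fun_continuous_plane; exact: modulus_continuous.
(* The first coordinate in the role of [p] gives the vertical lines, the second one the horizontal
   lines. *)
have whp1 (i : int) := @level_set_avoids_line _ _ _ _ _ _ z_distribution z_independent
  mu_rot s r1 s0 sr1 mus (@fst R R) (@measurable_fst _ _ _ _)
  (fun u v => ler_fst_modulus (u - v)) K K0
  (fun a delta delta0 => proj1 (Kstrip a delta delta0)) (i%:~R * h) (2 * B).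
have whp2 (i : int) := @level_set_avoids_line _ _ _ _ _ _ z_distribution z_independent
  mu_rot s r1 s0 sr1 mus (@snd R R) (@measurable_snd _ _ _ _)
  (fun u v => ler_snd_modulus (u - v)) K K0
  (fun a delta delta0 => proj2 (Kstrip a delta delta0)) (i%:~R * h) (2 * B).
have whp_lines := whp_and (whp_all (r := Is) (fun i _ => whp1 i))
  (whp_all (r := Is) (fun i _ => whp2 i)).
have whp_f := sample_law_of_large_numbers z_distribution z_independent bf e80.
have whp_D := sample_law_of_large_numbers z_distribution z_independent bD e10.
apply: whp_impl (whp_and whp_box (whp_and whp_lines (whp_and whp_f whp_D))) => n t n0.
move=> [box [[lines1 lines2] [lln_f lln_D]]]; rewrite XE.
have zB k : modulus (z k t) <= B by rewrite leNgt; exact/negP.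
have avoid (u : R * R) (i : int) : u.1 = i%:~R * h \/ u.2 = i%:~R * h ->
    r1 <= modulus u -> modulus u <= 2 * B ->
    \prod_(k < n) modulus (z k t) < \prod_(k < n) modulus (u - z k t).
  move=> ui ru uB; case: ui => ui.
    apply: (lines1 i) => //; apply: IsP; rewrite -ui.
    exact: le_trans (ler_fst_modulus u) uB.
  apply: (lines2 i) => //; apply: IsP; rewrite -ui.
  exact: le_trans (ler_snd_modulus u) uB.
have := sum_solutions_close n0 h0 (w_solutions n t) zB avoid M0 (ltW e80) fM f_close.
set Sw := \sum_(0 <= k < n) f (w n k t); set Sz := \sum_(0 <= k < n) f (z k t) in lln_f *.
set N1 := \sum_(0 <= k < n) _ => close.
have nn0 : 0 < n%:R :> R by rewrite ltr0n.
have N1le : N1 <= \sum_(0 <= k < n) \1_[set u : R * R | modulus u < r] (z k t).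
  apply: ler_sum => k _; rewrite !indicE.
  have [/set_mem/= zk|_] := boolP (z k t \in [set u | modulus u < r1 + 2 * h]); last first.
    by case: (_ \in _).
  rewrite mem_set//=; apply: lt_le_trans zk _.
  by rewrite -lerBrDl h2 ge_min lexx orbT.
have hole : n%:R^-1 * N1 <= e / (8 * (M + 1)).
  apply: (@le_trans _ _ (n%:R^-1 * \sum_(0 <= k < n) \1_[set u : R * R | modulus u < r] (z k t))).
    by rewrite ler_pM2l ?invr_gt0.
  move: lln_D; rewrite ler_norml => /andP[_].
  have -> : e / (8 * (M + 1)) = e / (16 * (M + 1)) + e / (16 * (M + 1)).
    by field; rewrite gt_eqF// ltr_wpDl.
  by move: ED; lra.
have Mhole : M * (n%:R^-1 * N1) <= e / 8.
  apply: le_trans (ler_wpM2l M0 hole) _.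
  have -> : M * (e / (8 * (M + 1))) = e / 8 * (M / (M + 1)).
    by field; rewrite gt_eqF// ltr_wpDl.
  by rewrite ler_piMr ?(ltW e80)// ler_pdivrMr ?ltr_wpDl// mul1r lerDl.
have closen : `|n%:R^-1 * Sw - n%:R^-1 * Sz| <= 2 * (e / 8 + M * (n%:R^-1 * N1)).
  rewrite -mulrBr normrM gtr0_norm ?invr_gt0// ler_pdivrMl//.
  apply: le_trans close _.
  have -> : n%:R * (2 * (e / 8 + M * (n%:R^-1 * N1))) = 2 * (n%:R * (e / 8) + M * N1).
    by field; rewrite gt_eqF.
  by [].
move: closen lln_f; rewrite !ler_norml ltr_norml => /andP[c1 c2] /andP[l1 l2].
by apply/andP; split; lra.
Qed.
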